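(* With the notation of the context, $\widehat{\pi_2}_*(\Gamma)\subset M$: more precisely, $\widehat{\pi_2}_*$ annihilates $\hat R$ (because $\widehat{\pi_2}_*\hat R=\widehat{\pi_2}_*\pi_{2*}\Omega_4=\pi_{4*}\Omega_4=0$), and on the $\mathbb Q$-generators $n_1,\dots,n_8$ of $N$ it is given by $$\widehat{\pi_2}_*n_1=m^1_1+2m^1_2+m^1_3,\qquad \widehat{\pi_2}_*n_2=m^3_1+2m^3_2+m^3_3,$$ $$\widehat{\pi_2}_*n_6=m^2_1+2m^2_2+m^2_3,\qquad \widehat{\pi_2}_*n_7=m^4_1+2m^4_2+m^4_3,$$ $$\widehat{\pi_2}_*n_3=\widehat{\pi_2}_*n_4=\tilde m^1,\qquad \widehat{\pi_2}_*n_5=\widehat{\pi_2}_*n_8=\tilde m^2,$$ so that, for $A_1^{\oplus8}=\langle n_1,\dots,n_8\rangle$, one has $\widehat{\pi_2}_*A_1^{\oplus8}=A_1(2)^{\oplus4}\oplus A_1^{\oplus2}$.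
   Context: Let $X$ be a K3 surface with a symplectic automorphism $\tau$ of order $4$; $\tilde Z$, $\tilde Y$ are the minimal resolutions of $X/\tau^2$ and $X/\tau$; $\tau$ induces an involution $\hat\tau$ on $\tilde Z$ and the minimal resolution of $\tilde Z/\hat\tau$ is isomorphic to $\tilde Y$. $\pi_2:X\dashrightarrow\tilde Z$, $\pi_4:X\dashrightarrow\tilde Y$, $\widehat{\pi_2}:\tilde Z\dashrightarrow\tilde Y$ are the rational quotient maps; for a rational map $\pi:S\dashrightarrow T$ resolved as $S\xleftarrow{b}S'\xrightarrow{p}T$, set $\pi_*=p_*b^*$ on $H^2(\cdot,\mathbb Z)$. $\Omega_4=(H^2(X,\mathbb Z)^{\tau^*})^\perp$. Marking of $H^2(X,\mathbb Z)$: it contains with finite index $W=D_4^{\oplus4}\oplus A_1^{\oplus2}\oplus\langle-4\rangle\oplus\langle4\rangle\oplus\langle2\rangle\oplus\langle2\rangle$ ($D_4,A_1$ negative definite), with generators $\{e_i\},\{f_i\},\{g_i\},\{h_i\}$ of the copies of $D_4$ (third element meeting each of the others once), $a_1,a_2$, $\sigma$, $\rho$, $\omega_1,\omega_2$, such that $\tau^*:e_i\mapsto f_i\mapsto g_i\mapsto h_i\mapsto e_i$, $a_1\leftrightarrow a_2$, $\sigma\mapsto-\sigma$, and $\rho,\omega_1,\omega_2$ are fixed. $H^2(X,\mathbb Z)$ is generated by $W$ and $\chi=(\rho+\sigma)/2$, $\alpha=(\rho+\sigma)/4+(e_1+e_2+f_1+f_4)/2$, $\beta=\tau^*\alpha$,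 $\gamma=\tau^*\beta$, $\delta=\tau^*\gamma$, $\varepsilon=(\rho+f_2+f_4+h_2+h_4+a_1+a_2)/2$, $\zeta=(e_1+f_1+e_4+f_2+a_1+\omega_1)/2$, $\eta=(e_1+f_1+e_4+f_2+a_2+\omega_2)/2$. A hat denotes the image under $\pi_{2*}$ (e.g. $\hat e_i=\pi_{2*}e_i=\pi_{2*}g_i$, $\hat f_i=\pi_{2*}f_i=\pi_{2*}h_i$) and a bar the image under $\pi_{4*}$ (e.g. $\overline a=\pi_{4*}a_1=\pi_{4*}a_2$). $N\subset H^2(\tilde Z,\mathbb Z)$ is the Nikulin lattice generated by the eight exceptional curves $n_1,\dots,n_8$ of $\tilde Z\to X/\tau^2$ and $\frac12\sum n_i$. The curves are numbered so that $H^2(\tilde Z,\mathbb Z)$ is generated by $\pi_{2*}H^2(X,\mathbb Z)\oplus N$ and $z_1=(\hat\beta+\hat f_1+\hat f_2+\hat a_2+\hat\eta)/2+(n_2+n_8)/2$, $z_2=\hat\varepsilon/2+(n_3+n_8)/2$, $z_3=\hat a_2/2+(n_4+n_8)/2$, $z_4=(\hat\varepsilon+\hat a_2+\hat\rho)/2+(n_5+n_8)/2$, $z_5=(\hat\beta+\hat f_1+\hat f_2+\hat\rho+\hat\chi+\hat\eta)/2+(n_6+n_8)/2$, $z_6=(\hat\beta+\hat f_1+\hat f_2+\hat\varepsilon+\hat a_2+\hat\rho+\hat\zeta)/2+(n_7+n_8)/2$. $\hat R=\pi_{2*}\Omega_4$, spanned by $\hat e_1-\hat f_1,\hat\alpha-\hat\beta,\hat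 e_3-\hat f_3,\hat e_4-\hat f_4,\hat\sigma,(\hat a_1-\hat a_2+\hat\sigma)/2$. $\Gamma\subset H^2(\tilde Z,\mathbb Z)$ is generated by $\hat R\oplus N$, $(n_3+n_4+n_5+n_8+\hat\sigma)/2$ and $(n_3+n_4+(\hat e_1-\hat f_1)+(\hat e_4-\hat f_4))/2+(\hat a_1-\hat a_2+\hat\sigma)/4$. $M\subset H^2(\tilde Y,\mathbb Z)$ is the minimal primitive sublattice containing the exceptional curves of $\tilde Y\to X/\tau$, which form four $A_3$ configurations $m^i_1,m^i_2,m^i_3$ ($i=1,\dots,4$, $m^i_2$ meeting $m^i_1$ and $m^i_3$) and two further curves $\tilde m^1,\tilde m^2$; $M$ is generated by these and $\mu=\frac14\sum_i(m^i_1+2m^i_2+3m^i_3)+\frac12(\tilde m^1+\tilde m^2)$. The curves are numbered so that $H^2(\tilde Y,\mathbb Z)$ is generated by $M\oplus\pi_{4*}H^2(X,\mathbb Z)$ and $y_1=(m^2_1+2m^2_2+3m^2_3+m^3_1+2m^3_2+3m^3_3)/4+\tilde m^2/2+(\overline e_1+\overline e_4+\overline\zeta+\overline\eta)/2+(\overline a+\overline\chi)/4$, $y_2=(m^3_1+2m^3_2+3m^3_3+m^4_1+2m^4_2+3m^4_3)/4+\tilde m^2/2+(\overline a+\overline\zeta+3\overline\eta)/4$, $y_3=(m^4_1+m^4_3+\tilde m^2)/2+(\overline e_1+\overline e_4+\overline\alpha+\overline\chi+\overline\zeta)/2$, $y_4=(\tilde m^1+\tilde m^2)/2+\overline a/2$.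 $A_1=\langle-2\rangle$ and $A_1(2)=\langle-4\rangle$. *)

(* Defs.v *)
From HB Require Import structures.
From mathcomp Require Import all_boot all_order all_algebra.
From mathcomp Require Import complex.
From mathcomp Require Import classical_sets cardinality reals.

Set Implicit Arguments.
Unset Strict Implicit.
Unset Printing Implicit Defensive.

Import Order.TTheory GRing.Theory Num.Theory.

Local Open Scope card_scope.
Local Open Scope classical_set_scope.
Local Open Scope ring_scope.

(* One-based access to a finite family: v⟦1⟧ is its first member. *)
Notation "v ⟦ k ⟧" := (v (inord (k%N).-1))
  (at level 2, left associativity, format "v ⟦ k ⟧").

Section Subgroups.
Variable V : zmodType.

Definition is_subgroup (L : set V) : Prop :=
  L 0 /\ forall x y, L x -> L y -> L (x - y).

Definition is_primitive (L : set V) : Prop :=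
  is_subgroup L /\
  forall (k : nat) x, (0 < k)%N -> L (x *+ k) -> L x.

Definition zspan (A : set V) : set V := smallest is_subgroup A.
Definition primitive_closure (A : set V) : set V := smallest is_primitive A.
End Subgroups.

(* Compact connected complex surfaces and holomorphic maps are not available in
   the libraries, so they are described by an interface.  [geometry] lists the
   notions used:
   - [curve S] is the set of irreducible compact curves of S, as point sets;
   - [H2 S] is the second integral cohomology group modulo torsion (so H^2
     itself for a K3 surface), with intersection form [cup];
   - [cls C] is the cohomology class of C, meaningful only for a curve C;
   - [push f] is the Gysin map, [deg f] the degree (0 if f is not surjective);
   - [form2 S] is the space of holomorphic 2-forms, [zeros w] the vanishing
     locus of w, and [b1 S] the first Betti number.
   [geometry_laws] collects general facts about them.  Holomorphic maps of
   degree 1 are the bimeromorphic ones. *)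
Record geometry (R : realType) := Geometry {
  surf : Type;
  pt : surf -> Type;
  mor : surf -> surf -> Type;
  ev : forall {S T : surf}, mor S T -> pt S -> pt T;
  idm : forall S : surf, mor S S;
  compm : forall {S T U : surf}, mor T U -> mor S T -> mor S U;
  deg : forall {S T : surf}, mor S T -> nat;
  curve : forall S : surf, set (set (pt S));
  H2 : surf -> zmodType;
  cup : forall {S : surf}, H2 S -> H2 S -> int;
  cls : forall {S : surf}, set (pt S) -> H2 S;
  pull : forall {S T : surf}, mor S T -> H2 T -> H2 S;
  push : forall {S T : surf}, mor S T -> H2 S -> H2 T;
  b1 : surf -> nat;
  form2 : surf -> lmodType R[i];
  zeros : forall {S : surf}, form2 S -> set (pt S);
  pull2 : forall {S T : surf}, mor S T -> form2 T -> form2 S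
}.

Arguments pt {R g}.
Arguments mor {R g}.
Arguments idm {R g}.
Arguments curve {R g}.
Arguments H2 {R g}.
Arguments b1 {R g}.
Arguments form2 {R g}.
Coercion ev : mor >-> Funclass.

Section SurfaceNotions.
Variables (R : realType) (G : geometry R).
Implicit Types S T : surf G.

(* Closed analytic subsets of a surface other than the surface itself are
   contained in sets of this kind. *)
Definition thin S (A : set (pt S)) : Prop :=
  exists (F : set (pt S)) (k : nat) (C : 'I_k -> set (pt S)),
    [/\ finite_set F, forall i, curve S (C i)
      & A `<=` F `|` \bigcup_i C i].

Definition constant_on S (U : Type) (r : pt S -> U) (C : set (pt S)) : Prop :=
  exists u, r @` C = [set u].

Definition is_K3 S : Prop :=
  b1 S = 0%N /\ exists w : form2 S, zeros w = set0.

Definition symplectic S (g : mor S S) : Prop :=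
  forall w : form2 S, pull2 g w = w.

Definition mor_pow S (g : mor S S) (k : nat) : mor S S :=
  iter k (compm g) (idm S).

Definition has_order S (g : mor S S) (N : nat) : Prop :=
  [/\ (0 < N)%N, mor_pow g N = idm S
    & forall k, (0 < k < N)%N -> mor_pow g k <> idm S].

Record geometry_laws : Prop := GeometryLaws {
  ev_id : forall S (x : pt S), idm S x = x;
  ev_comp : forall S T U (f : mor T U) (g : mor S T) x,
    compm f g x = f (g x);
  identity_principle : forall S T (f g : mor S T) (A : set (pt S)),
    thin A -> (forall x, ~ A x -> f x = g x) -> f = g;

  deg_id : forall S, deg (idm S) = 1%N;
  deg_comp : forall S T U (f : mor T U) (g : mor S T),
    deg (compm f g) = (deg f * deg g)%N;
  deg_fibre : forall S T (f : mor S T), exists2 A : set (pt T),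
    thin A & forall t, ~ A t -> f @^-1` [set t] #= `I_(deg f);
  thin_preimage : forall S T (f : mor S T) (A : set (pt T)),
    (0 < deg f)%N -> thin A -> thin (f @^-1` A);

  cupC : forall S (x y : H2 S), cup x y = cup y x;
  cupDl : forall S (x y z : H2 S), cup (x + y) z = cup x z + cup y z;
  H2_finite : forall S, exists (k : nat) (v : 'I_k -> H2 S),
    zspan (range v) = setT;
  H2_unimodular : forall S (phi : H2 S -> int),
    {morph phi : x y / x + y} -> exists! u, forall x, phi x = cup u x;

  pullD : forall S T (f : mor S T), {morph pull f : x y / x + y};
  pull_id : forall S (x : H2 S), pull (idm S) x = x;
  pull_comp : forall S T U (f : mor T U) (g : mor S T) x,
    pull (compm f g) x = pull g (pull f x);
  projection_formula : forall S T (f : mor S T) x y,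
    cup (push f x) y = cup x (pull f y);
  cup_pull : forall S T (f : mor S T) x y,
    cup (pull f x) (pull f y) = cup x y *+ deg f;

  curve_infinite : forall S (C : set (pt S)), curve S C -> infinite_set C;
  curve_meet : forall S (C D : set (pt S)), curve S C -> curve S D -> C <> D ->
    [/\ finite_set (C `&` D), 0 <= cup (cls C) (cls D)
      & cup (cls C) (cls D) = 0 <-> C `&` D = set0];
  push_curve : forall S T (f : mor S T) (C : set (pt S)), curve S C ->
    (constant_on f C /\ push f (cls C) = 0) \/
    (curve T (f @` C) /\ exists d : nat,
      [/\ (0 < d)%N, push f (cls C) = cls (f @` C) *+ d
        & finite_set
            [set t | (f @` C) t /\ ~ (C `&` f @^-1` [set t] #= `I_d)]]);
  pull_curve : forall S T (f : mor S T) (D : set (pt T)),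
    (0 < deg f)%N -> curve T D ->
    exists (k : nat) (C : 'I_k -> set (pt S)) (c : 'I_k -> nat),
      (forall i, curve S (C i) /\ C i `<=` f @^-1` D) /\
      pull f (cls D) = \sum_i cls (C i) *+ c i;

  (* a bimeromorphic holomorphic map is a composite of blow-ups *)
  bimeromorphic_kernel : forall S T (b : mor S T) x,
    deg b = 1%N -> push b x = 0 ->
    zspan [set cls C | C in [set C | curve S C /\ constant_on b C]] x;
  (* desingularize the main component of the fibre product of f and b *)
  domination : forall S T T' (f : mor S T) (b : mor T' T),
    (0 < deg f)%N -> deg b = 1%N ->
    exists (S' : surf G) (c : mor S' S) (q : mor S' T'),
      deg c = 1%N /\ compm b q = compm f c;

  pull2_linear : forall S T (f : mor S T) (a : R[i]) (v w : form2 T),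
    pull2 f (a *: v + w) = a *: pull2 f v + pull2 f w;
  pull2_id : forall S (w : form2 S), pull2 (idm S) w = w;
  pull2_comp : forall S T U (f : mor T U) (g : mor S T) w,
    pull2 (compm f g) w = pull2 g (pull2 f w);
  zeros0 : forall S, zeros (0 : form2 S) = setT;
  zerosZ : forall S (a : R[i]) (w : form2 S), a != 0 ->
    zeros (a *: w) = zeros w;
  zeros_pull2 : forall S T (f : mor S T) (g : mor T S) (w : form2 T),
    compm f g = idm T -> compm g f = idm S ->
    zeros (pull2 f w) = f @^-1` zeros w;
  K3_rank : forall S, is_K3 S -> exists v : 'I_22 -> H2 S,
    forall x, exists! c : 'rV[int]_22, x = \sum_i v i *~ c 0 i;
  K3_even : forall S (x : H2 S), is_K3 S -> (2 %| cup x x)%Z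
}.

(* The points of the quotient of S by the cyclic group generated by g are the
   orbits [orb g x]; a map to the quotient is a map to [set (pt S)]. *)
Definition orb S (g : mor S S) (x : pt S) : set (pt S) :=
  [set y | exists k : nat, y = iter k g x].

Definition free_at S (g : mor S S) (N : nat) (x : pt S) : Prop :=
  forall k, (0 < k < N)%N -> iter k g x <> x.

Definition exceptional S T (r : pt T -> set (pt S)) (C : set (pt T)) : Prop :=
  curve T C /\ constant_on r C.

(* r : T -> S/g is the minimal resolution of the quotient by g, of order N.
   The points with nontrivial stabilizer are supposed to give singular points
   of S/g, as is the case for symplectic actions; S/g being normal, the fibres
   of r are connected.  Exceptional curves over quotient singularities are
   rational, so minimality amounts to the absence of self-intersection -1. *)
Record min_resolution S T (g : mor S S) (N : nat) (r : pt T -> set (pt S)) :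
    Prop := MinResolution {
  mr_orbit : forall t, exists x, r t = orb g x;
  mr_free : forall x, free_at g N x ->
    exists t, r @^-1` [set orb g x] = [set t];
  mr_singular : forall x, ~ free_at g N x ->
    exists (k : nat) (C : 'I_k -> set (pt T)),
      [/\ (0 < k)%N, forall i, curve T (C i)
        & r @^-1` [set orb g x] = \bigcup_i C i];
  mr_connected : forall x (k l : nat)
      (C : 'I_k -> set (pt T)) (D : 'I_l -> set (pt T)),
    (0 < k)%N -> (0 < l)%N ->
    (forall i, curve T (C i)) -> (forall j, curve T (D j)) ->
    r @^-1` [set orb g x] = (\bigcup_i C i) `|` (\bigcup_j D j) ->
    (\bigcup_i C i) `&` (\bigcup_j D j) !=set0;
  mr_minimal : forall C, exceptional r C -> cup (cls C) (cls C) <> -1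
}.

(* The rational quotient map S --> T over S/g, given by a resolution
   S <- mid -> T of its indeterminacies. *)
Record quotient_map S T (g : mor S S) (r : pt T -> set (pt S)) := QuotientMap {
  mid : surf G;
  down : mor mid S;
  up : mor mid T;
  deg_down : deg down = 1%N;
  deg_up : (0 < deg up)%N;
  quotient_mapE : forall s, r (up s) = orb g (down s)
}.

Definition rpush S T (g : mor S S) (r : pt T -> set (pt S))
    (q : quotient_map g r) (x : H2 S) : H2 T :=
  push (up q) (pull (down q) x).

Definition coinvariant_lattice S (g : mor S S) : set (H2 S) :=
  [set x | forall y, pull g y = y -> cup x y = 0].

(* L is freely generated by an orthogonal family with the given squares. *)
Definition is_diagonal_lattice S (L : set (H2 S)) (ds : seq int) : Prop :=
  exists v : 'I_(size ds) -> H2 S,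
    [/\ forall i j, cup (v i) (v j) = if i == j then ds`_i else 0,
        forall c : 'I_(size ds) -> int,
          \sum_i v i *~ c i = 0 -> forall i, c i = 0
      & L = zspan (range v)].

(* Negative definite D4 with the third root as centre (indices from 0). *)
Definition D4 (i j : 'I_4) : int :=
  if i == j then -2
  else if (i == 2%N :> nat) || (j == 2%N :> nat) then 1 else 0.

Definition A3 (i j : 'I_3) : int :=
  if i == j then -2
  else if (i == 1%N :> nat) || (j == 1%N :> nat) then 1 else 0.

(* Rational identities in the torsion-free groups H2 are stated with cleared
   denominators, here and below. *)
Record marking (X : surf G) (tau : mor X X) := Marking {
  e_ : 'I_4 -> H2 X;  f_ : 'I_4 -> H2 X;  g_ : 'I_4 -> H2 X;  h_ : 'I_4 -> H2 X;
  a_ : 'I_2 -> H2 X;  sigma : H2 X;  rho : H2 X;  omega_ : 'I_2 -> H2 X;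
  chi : H2 X;  alpha : H2 X;  beta : H2 X;  gamma : H2 X;  delta : H2 X;
  epsilon : H2 X;  zeta : H2 X;  eta : H2 X;

  W_gram_D4 : forall k l i j : 'I_4,
    cup (tnth [tuple e_; f_; g_; h_] k i) (tnth [tuple e_; f_; g_; h_] l j)
      = if k == l then D4 i j else 0;
  W_gram_rest : forall i j : 'I_6,
    let w := [tuple a_⟦1⟧; a_⟦2⟧; sigma; rho; omega_⟦1⟧; omega_⟦2⟧] in
    cup (tnth w i) (tnth w j)
      = if i == j then [:: -2; -2; -4; 4; 2; 2]`_i else 0;
  W_gram_cross : forall (k i : 'I_4) (j : 'I_6),
    let w := [tuple a_⟦1⟧; a_⟦2⟧; sigma; rho; omega_⟦1⟧; omega_⟦2⟧] in
    cup (tnth [tuple e_; f_; g_; h_] k i) (tnth w j) = 0;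

  tau_D4 : forall i, [/\ pull tau (e_ i) = f_ i, pull tau (f_ i) = g_ i,
    pull tau (g_ i) = h_ i & pull tau (h_ i) = e_ i];
  tau_a : pull tau a_⟦1⟧ = a_⟦2⟧ /\ pull tau a_⟦2⟧ = a_⟦1⟧;
  tau_sigma : pull tau sigma = - sigma;
  tau_rho : pull tau rho = rho;
  tau_omega : forall i, pull tau (omega_ i) = omega_ i;

  chiE : chi *+ 2 = rho + sigma;
  alphaE : alpha *+ 4 = rho + sigma + (e_⟦1⟧ + e_⟦2⟧ + f_⟦1⟧ + f_⟦4⟧) *+ 2;
  betaE : beta = pull tau alpha;
  gammaE : gamma = pull tau beta;
  deltaE : delta = pull tau gamma;
  epsilonE : epsilon *+ 2
    = rho + f_⟦2⟧ + f_⟦4⟧ + h_⟦2⟧ + h_⟦4⟧ + a_⟦1⟧ + a_⟦2⟧;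
  zetaE : zeta *+ 2 = e_⟦1⟧ + f_⟦1⟧ + e_⟦4⟧ + f_⟦2⟧ + a_⟦1⟧ + omega_⟦1⟧;
  etaE : eta *+ 2 = e_⟦1⟧ + f_⟦1⟧ + e_⟦4⟧ + f_⟦2⟧ + a_⟦2⟧ + omega_⟦2⟧;

  marking_generates : zspan
    (range e_ `|` range f_ `|` range g_ `|` range h_ `|` range a_
     `|` range omega_ `|`
     [set sigma; rho; chi; alpha; beta; gamma; delta; epsilon; zeta; eta])
    = setT
}.

(* The numbering of the exceptional curves of Z -> X/tau^2; p is the push-forward
   from H^2(X) to H^2(Z). *)
Record numbering_Z (X Z : surf G) (tau : mor X X) (mk : marking tau)
    (r : pt Z -> set (pt X)) (p : H2 X -> H2 Z) := NumberingZ {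
  n_curve : 'I_8 -> set (pt Z);
  n_ := fun i => cls (n_curve i);
  nu : H2 Z;
  z_ : 'I_6 -> H2 Z;

  n_exceptional : forall C, exceptional r C <-> exists i, C = n_curve i;
  n_gram : forall i j, cup (n_ i) (n_ j) = if i == j then -2 else 0;
  nuE : nu *+ 2 = \sum_i n_ i;

  z1E : z_⟦1⟧ *+ 2 = p (beta mk) + p (f_ mk)⟦1⟧ + p (f_ mk)⟦2⟧ + p (a_ mk)⟦2⟧
    + p (eta mk) + n_⟦2⟧ + n_⟦8⟧;
  z2E : z_⟦2⟧ *+ 2 = p (epsilon mk) + n_⟦3⟧ + n_⟦8⟧;
  z3E : z_⟦3⟧ *+ 2 = p (a_ mk)⟦2⟧ + n_⟦4⟧ + n_⟦8⟧;
  z4E : z_⟦4⟧ *+ 2 = p (epsilon mk) + p (a_ mk)⟦2⟧ + p (rho mk) + n_⟦5⟧ + n_⟦8⟧;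
  z5E : z_⟦5⟧ *+ 2 = p (beta mk) + p (f_ mk)⟦1⟧ + p (f_ mk)⟦2⟧ + p (rho mk)
    + p (chi mk) + p (eta mk) + n_⟦6⟧ + n_⟦8⟧;
  z6E : z_⟦6⟧ *+ 2 = p (beta mk) + p (f_ mk)⟦1⟧ + p (f_ mk)⟦2⟧ + p (epsilon mk)
    + p (a_ mk)⟦2⟧ + p (rho mk) + p (zeta mk) + n_⟦7⟧ + n_⟦8⟧;

  numbering_Z_generates :
    zspan (range p `|` zspan (range n_ `|` [set nu]) `|` range z_) = setT
}.

Definition nikulin_lattice (X Z : surf G) (tau : mor X X) (mk : marking tau)
    (r : pt Z -> set (pt X)) (p : H2 X -> H2 Z) (nz : numbering_Z mk r p) :
    set (H2 Z) :=
  zspan (range (n_ nz) `|` [set nu nz]).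

(* The numbering of the exceptional curves of Y -> X/tau; p is the push-forward
   from H^2(X) to H^2(Y).  [m_ i j] and [mt_ k] stand for m^i_j and ~m^k. *)
Record numbering_Y (X Y : surf G) (tau : mor X X) (mk : marking tau)
    (r : pt Y -> set (pt X)) (p : H2 X -> H2 Y) := NumberingY {
  m_curve : 'I_4 -> 'I_3 -> set (pt Y);
  mt_curve : 'I_2 -> set (pt Y);
  m_ := fun i j => cls (m_curve i j);
  mt_ := fun k => cls (mt_curve k);
  exceptional_lattice : set (H2 Y) :=
    primitive_closure [set cls C | C in exceptional r];
  mu : H2 Y;
  y_ : 'I_4 -> H2 Y;

  m_exceptional : forall C, exceptional r C <->
    (exists i j, C = m_curve i j) \/ (exists k, C = mt_curve k);
  m_gram : forall i i' j j',
    cup (m_ i j) (m_ i' j') = if i == i' then A3 j j' else 0;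
  mt_gram : forall k k', cup (mt_ k) (mt_ k') = if k == k' then -2 else 0;
  m_mt_gram : forall i j k, cup (m_ i j) (mt_ k) = 0;
  muE : mu *+ 4 = \sum_i ((m_ i)⟦1⟧ + (m_ i)⟦2⟧ *+ 2 + (m_ i)⟦3⟧ *+ 3)
    + (mt_⟦1⟧ + mt_⟦2⟧) *+ 2;
  exceptional_latticeE : exceptional_lattice
    = zspan ([set cls C | C in exceptional r] `|` [set mu]);

  y1E : y_⟦1⟧ *+ 4 = m_⟦2⟧⟦1⟧ + m_⟦2⟧⟦2⟧ *+ 2 + m_⟦2⟧⟦3⟧ *+ 3
    + m_⟦3⟧⟦1⟧ + m_⟦3⟧⟦2⟧ *+ 2 + m_⟦3⟧⟦3⟧ *+ 3 + mt_⟦2⟧ *+ 2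
    + (p (e_ mk)⟦1⟧ + p (e_ mk)⟦4⟧ + p (zeta mk) + p (eta mk)) *+ 2
    + p (a_ mk)⟦1⟧ + p (chi mk);
  y2E : y_⟦2⟧ *+ 4 = m_⟦3⟧⟦1⟧ + m_⟦3⟧⟦2⟧ *+ 2 + m_⟦3⟧⟦3⟧ *+ 3
    + m_⟦4⟧⟦1⟧ + m_⟦4⟧⟦2⟧ *+ 2 + m_⟦4⟧⟦3⟧ *+ 3 + mt_⟦2⟧ *+ 2
    + p (a_ mk)⟦1⟧ + p (zeta mk) + p (eta mk) *+ 3;
  y3E : y_⟦3⟧ *+ 2 = m_⟦4⟧⟦1⟧ + m_⟦4⟧⟦3⟧ + mt_⟦2⟧
    + p (e_ mk)⟦1⟧ + p (e_ mk)⟦4⟧ + p (alpha mk) + p (chi mk) + p (zeta mk);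
  y4E : y_⟦4⟧ *+ 2 = mt_⟦1⟧ + mt_⟦2⟧ + p (a_ mk)⟦1⟧;

  numbering_Y_generates :
    zspan (exceptional_lattice `|` range p `|` range y_) = setT
}.

End SurfaceNotions.

(* Main.v *)
(* Let P be the push-forward from Z to Y and Q its adjoint for the
   intersection forms. Both preserve classes of effective curves lying over
   the branch points, P Q is multiplication by 2 up to the curves contracted
   by Y -> Z/tauh, and these are killed by Q. So the form 2 (x, proj y), proj
   being the projection away from the contracted curves, is computed on the
   exceptional curves of Y by nonnegative vectors in the negative definite
   diagonal lattice <n_1, ..., n_8>. This only allows the outer curves, or
   all curves, of an A_3 configuration to be contracted, and each P n_i is 0,
   some m_1 + 2 m_2 + m_3, or some mt_k. The relations defining the z_j,
   pushed to Y and compared with the y_j, give elements of M whose doubles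
   are sums of two P n_i up to known terms; reduction modulo 2M then
   determines each P n_i. *)
Require Import Defs.
From HB Require Import structures.
From mathcomp Require Import all_boot all_order all_algebra zify.
From mathcomp Require Import complex.
From mathcomp Require Import boolp classical_sets functions cardinality reals.

Set Implicit Arguments.
Unset Strict Implicit.
Unset Printing Implicit Defensive.

Import Order.TTheory GRing.Theory Num.Theory.

Import Defs.

Local Open Scope card_scope.
Local Open Scope classical_set_scope.
Local Open Scope ring_scope.

(** * Additive maps of abelian groups *)

Section AdditiveMaps.
Variables (U V : zmodType) (f : U -> V).
Hypothesis fD : {morph f : x y / x + y}.

Lemma morphD0 : f 0 = 0.
Proof. by apply: (addrI (f 0)); rewrite -fD !addr0. Qed.

Lemma morphDN : {morph f : x / - x}.
Proof. by move=> x; apply: (addrI (f x)); rewrite -fD !subrr morphD0. Qed.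

Lemma morphDB : {morph f : x y / x - y}.
Proof. by move=> x y; rewrite fD morphDN. Qed.

Lemma morphDMn k : {morph f : x / x *+ k}.
Proof.
by elim: k => [|k IH] x; rewrite ?mulr0n ?morphD0 // !mulrS fD IH.
Qed.

Lemma morphDMz (k : int) : {morph f : x / x *~ k}.
Proof. by case: k => k x; rewrite ?NegzE ?mulrNz ?morphDN -!pmulrn morphDMn. Qed.

Lemma morphD_sum (I : finType) (F : I -> U) : f (\sum_i F i) = \sum_i f (F i).
Proof. exact: (big_morph f fD morphD0). Qed.

End AdditiveMaps.

(** * Subgroups, integral spans and primitive closures *)

Section Subgroups.
Variable V : zmodType.
Implicit Types (A B : set V) (I : finType).

Lemma is_subgroupD B x y : is_subgroup B -> B x -> B y -> B (x + y).
Proof.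
move=> [B0 BB] Bx By; rewrite -[y]opprK; apply: (BB) => //.
by rewrite -[- y]add0r; apply: (BB).
Qed.

Lemma is_subgroupMn B x k : is_subgroup B -> B x -> B (x *+ k).
Proof.
move=> sB Bx; elim: k => [|k IH]; first by rewrite mulr0n; case: sB.
by rewrite mulrS; apply: is_subgroupD.
Qed.

Lemma is_subgroup_sum B I (F : I -> V) :
  is_subgroup B -> (forall i, B (F i)) -> B (\sum_i F i).
Proof.
move=> sB BF; elim/big_ind: _ => // [|x y]; first by case: sB.
exact: is_subgroupD.
Qed.

Lemma zspan_min A B : is_subgroup B -> A `<=` B -> zspan A `<=` B.
Proof. exact: smallest_sub. Qed.

Lemma sub_zspan A : A `<=` zspan A.
Proof. exact: sub_gen_smallest. Qed.

Lemma zspan_subgroup A : is_subgroup (zspan A).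
Proof.
split=> [B [[B0 _] _] //|x y Ax Ay B BP].
by case: (BP) => [[_ BB] _]; apply: (BB); [apply: Ax|apply: Ay].
Qed.

Lemma zspan_mono A B : A `<=` B -> zspan A `<=` zspan B.
Proof.
move=> AB; apply: zspan_min; first exact: zspan_subgroup.
exact: subset_trans AB (@sub_zspan _).
Qed.

Lemma zspan_morph (W : zmodType) (f : V -> W) A (B : set W) :
  {morph f : x y / x + y} -> is_subgroup B -> (forall x, A x -> B (f x)) ->
  forall x, zspan A x -> B (f x).
Proof.
move=> fD [B0 BB] AB x; apply: (zspan_min (B := [set x | B (f x)])) x => //.
split=> /=; first by rewrite (morphD0 fD).
by move=> x y Bx By; rewrite (morphDB fD); apply: (BB).
Qed.

(** The coefficients are indexed by the whole finite type and vanish off [K], the form in which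
    negative definiteness is applied to combinations of contracted curves. *)
Lemma zspan_family I (K : set I) (v : I -> V) x :
  zspan [set v i | i in K] x ->
  exists2 c : I -> int, forall i, ~ K i -> c i = 0 & x = \sum_i v i *~ c i.
Proof.
pose B := [set x | exists2 c : I -> int,
  forall i, ~ K i -> c i = 0 & x = \sum_i v i *~ c i].
apply: (zspan_min (B := B)); first split=> [|y z [c c0 ->] [d d0 ->]].
- by exists (fun=> 0) => //; rewrite big1.
- exists (fun i => c i - d i) => [i Ki|]; first by rewrite c0 // d0 // subrr.
  by rewrite -sumrB; apply: eq_bigr => i _; rewrite mulrzBr.
- move=> _ [i Ki <-]; exists (fun j => (j == i)%:R) => [j Kj|].
    by case: eqP => // ji; rewrite ji in Kj.
  rewrite (bigD1 i) //= eqxx mulr1z big1 ?addr0 // => j /negPf ->.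
  by rewrite mulr0z.
Qed.

Lemma primitive_closure_primitive A : is_primitive (primitive_closure A).
Proof.
split; first split=> [B [[[B0 _] _] _] //|x y Ax Ay B pB].
  by case: (pB) => [[[_ BB] _] _]; apply: (BB); [apply: Ax|apply: Ay].
move=> k x k0 Ax B pB; case: (pB) => [[_ Bdiv] _].
by apply: Bdiv k0 _; apply: Ax.
Qed.

End Subgroups.

(** * The intersection form and Gysin maps *)

Section Intersection.
Variables (R : realType) (G : geometry R) (laws : geometry_laws G).
Implicit Types S T U : surf G.

Lemma cupDr S (z : H2 S) : {morph cup z : x y / x + y}.
Proof. by move=> x y; rewrite (cupC laws) (cupDl laws) !(cupC laws z). Qed.

Lemma cup0r S (x : H2 S) : cup x 0 = 0.
Proof. exact: morphD0 (cupDr x). Qed.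

Lemma cupBr S (z x y : H2 S) : cup z (x - y) = cup z x - cup z y.
Proof. exact: morphDB (cupDr z) _ _. Qed.

Lemma cupNr S (z x : H2 S) : cup z (- x) = - cup z x.
Proof. exact: morphDN (cupDr z) _. Qed.

Lemma cupMnr S (z x : H2 S) k : cup z (x *+ k) = cup z x *+ k.
Proof. exact: morphDMn (cupDr z) _ _. Qed.

Lemma cupMzr S (z x : H2 S) k : cup z (x *~ k) = cup z x * k.
Proof. by rewrite (morphDMz (cupDr z)) mulrzz. Qed.

Lemma cup_sumr S (z : H2 S) (I : finType) (F : I -> H2 S) :
  cup z (\sum_i F i) = \sum_i cup z (F i).
Proof. exact: morphD_sum (cupDr z) _ _. Qed.

Definition cupEr := (cupDr, cupNr, cupMnr, cupMzr, cup0r).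

(** By unimodularity the functional [fun z => cup z x] is represented by only one class. Identities
    in [H2] are proved from here on by pairing with an arbitrary class. *)
Lemma cup_inj S (x y : H2 S) : (forall z, cup z x = cup z y) -> x = y.
Proof.
move=> xy.
have cupD_x : {morph (fun z => cup z x) : a b / a + b}.
  by move=> a b; apply: (cupDl laws).
have [u [_ u_uniq]] := H2_unimodular laws cupD_x.
rewrite -[x]u_uniq => [|z]; last exact: cupC.
by apply: u_uniq => z; rewrite xy (cupC laws).
Qed.

Lemma H2_torsion_free S (x : H2 S) k : (0 < k)%N -> x *+ k = 0 -> x = 0.
Proof.
move=> k0 kx; apply: cup_inj => z; have := congr1 (cup z) kx.
by rewrite !cupEr; lia.
Qed.

(** Adjointness to [pull f] together with nondegeneracy determines the Gysin map; additivity,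
    functoriality and the formula for [push f (pull f y)] all follow in this way. *)
Lemma pushD S T (f : mor S T) : {morph push f : x y / x + y}.
Proof.
move=> x y; apply: cup_inj => z.
by rewrite cupDr !(cupC laws z) !(projection_formula laws) (cupDl laws).
Qed.

Lemma push_comp S T U (f : mor T U) (g : mor S T) x :
  push (compm f g) x = push f (push g x).
Proof.
apply: cup_inj => z.
by rewrite !(cupC laws z) !(projection_formula laws) (pull_comp laws).
Qed.

Lemma push_pull S T (f : mor S T) y : push f (pull f y) = y *+ deg f.
Proof.
apply: cup_inj => z.
rewrite cupMnr (cupC laws) (projection_formula laws) (cup_pull laws).
by rewrite (cupC laws).
Qed.

End Intersection.

(** * Thin sets, orbits and the fibres of minimal resolutions *)

Section RationalMaps.
Variables (R : realType) (G : geometry R) (laws : geometry_laws G).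
Implicit Types S T U : surf G.

Lemma thin_finite S (A : set (pt S)) : finite_set A -> thin A.
Proof.
move=> finA; exists A, 0%N, (fun=> set0); by split=> [|[]|x Ax] //; left.
Qed.

Lemma thinU S (A B : set (pt S)) : thin A -> thin B -> thin (A `|` B).
Proof.
move=> [F [k [C [finF curveC AF]]]] [E [l [D [finE curveD BE]]]].
exists (F `|` E), (k + l)%N,
  (fun i => match fintype.split i with inl a => C a | inr b => D b end).
split=> [|i|x]; first by rewrite finite_setU.
  by case: (fintype.split i).
case=> [/AF|/BE] [?|[i _ ix]]; [by left; left| |by left; right|].
  by right; exists (unsplit (inl i)) => //; rewrite unsplitK.
by right; exists (unsplit (inr i)) => //; rewrite unsplitK.
Qed.

Lemma curve_neq0 S (C : set (pt S)) : curve S C -> C !=set0.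
Proof. by move/(curve_infinite laws)/infinite_setN0. Qed.

Lemma constant_onP S (U : Type) (r : pt S -> U) (C : set (pt S)) u :
  C !=set0 -> (forall s, C s -> r s = u) -> constant_on r C.
Proof.
move=> [s Cs] rC; exists u; apply/seteqP; split=> [_ [t Ct <-]|_ ->].
  exact: rC.
by exists s => //; apply: rC.
Qed.

Lemma constant_on_eq S (U : Type) (r : pt S -> U) (C : set (pt S)) :
  constant_on r C -> exists u, forall s, C s -> r s = u.
Proof.
move=> [u rC]; exists u => s Cs.
have : (r @` C) (r s) by exists s.
by rewrite rC.
Qed.

Lemma mor_ext S T (f g : mor S T) : f =1 g -> f = g.
Proof.
move=> fg; apply: (identity_principle laws (thin_finite (finite_set0 _))).
by move=> x _; apply: fg.
Qed.

Section Automorphism.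
Variables (S : surf G) (g : mor S S) (N : nat).

Lemma mor_powE k x : mor_pow g k x = iter k g x.
Proof.
elim: k => [|k IH] /=; first exact: ev_id.
by rewrite (ev_comp laws) -IH.
Qed.

Lemma has_order_iter : has_order g N -> forall x, iter N g x = x.
Proof. by move=> [_ gN _] x; rewrite -mor_powE gN (ev_id laws). Qed.

(** The [N]-th power of [deg g] is the degree of the identity, so [deg g] divides 1. *)
Lemma has_order_deg : has_order g N -> deg g = 1%N.
Proof.
move=> [N0 gN _]; have degX k : deg (mor_pow g k) = (deg g ^ k)%N.
  elim: k => [|k IH]; first by rewrite (deg_id laws).
  by rewrite expnS -IH /mor_pow iterS (deg_comp laws).
by apply/eqP; rewrite -dvdn1 -(deg_id laws S) -gN degX dvdn_exp.
Qed.

Lemma orb_refl x : orb g x x.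
Proof. by exists 0%N. Qed.

Hypotheses (N0 : (0 < N)%N) (gN : forall x, iter N g x = x).

Lemma iter_modn k x : iter k g x = iter (k %% N) g x.
Proof.
rewrite {1}(divn_eq k N) addnC iterD; congr iter.
by elim: (k %/ N)%N => [|q IH] //; rewrite mulSn iterD IH gN.
Qed.

Lemma orb_finite x : finite_set (orb g x).
Proof.
apply: (@sub_finite_set _ _ ((fun k => iter k g x) @` `I_N)); last first.
  exact/finite_image/finite_II.
move=> y [k ->]; exists (k %% N)%N; first by rewrite /= ltn_mod.
by rewrite -iter_modn.
Qed.

Lemma orb_eq x y : orb g x y -> orb g y = orb g x.
Proof.
move=> [k ->]; apply/seteqP; split=> _ [l ->].
  by exists (l + k)%N; rewrite iterD.
(* Iterating [N - k %% N] times inverts the [k]-th iterate. *)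
exists (l + (N - k %% N))%N; rewrite (iter_modn k) iterD; congr iter.
by rewrite -iterD subnK ?gN // ltnW ?ltn_mod.
Qed.

Lemma orb_iter k x : orb g (iter k g x) = orb g x.
Proof. by apply: orb_eq; exists k. Qed.

End Automorphism.

Section MinimalResolution.
Variables (S T : surf G) (g : mor S S) (N : nat) (r : pt T -> set (pt S)).
Hypotheses (N0 : (0 < N)%N) (gN : forall x, iter N g x = x).
Hypothesis res : min_resolution g N r.

Lemma fibre_neq0 x : exists t, r t = orb g x.
Proof.
have [/(mr_free res)[t rt]|/(mr_singular res)[k [C [k0 cC rC]]]] :=
  pselect (free_at g N x).
  by exists t; have : [set t] t by []; rewrite -rt.
have [t Ct] := curve_neq0 (cC (Ordinal k0)); exists t.
have : (\bigcup_i C i) t by exists (Ordinal k0).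
by rewrite -rC.
Qed.

Lemma fibre_uniq x t t' :
  free_at g N x -> r t = orb g x -> r t' = orb g x -> t = t'.
Proof.
move=> /(mr_free res)[u rx] rt rt'.
by have [-> ->] : [set u] t /\ [set u] t' by rewrite -rx.
Qed.

Section FiniteExceptional.
Variables (I : finType) (E : I -> set (pt T)).
Hypothesis exE : forall C, exceptional r C -> exists i, C = E i.

Lemma fibre_nonfree x : ~ free_at g N x ->
  forall t, r t = orb g x -> exists2 i, E i t & exceptional r (E i).
Proof.
move=> /(mr_singular res)[k [C [k0 cC rC]]] t rt.
have [i _ Cit] : (\bigcup_i C i) t by rewrite -rC.
have exC : exceptional r (C i).
  split=> //; apply: (@constant_onP _ _ _ _ (orb g x)).
    exact: curve_neq0.
  by move=> s Cs; have : (\bigcup_i C i) s by [exists i]; rewrite -rC.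
by have [j Ej] := exE exC; exists j; rewrite -Ej.
Qed.

(** Over a nonfree point lies some exceptional [E i], on which [r] takes the orbit of that point as
    its only value. So finitely many curves account for finitely many orbits, each of them
    finite. *)
Lemma nonfree_finite : finite_set [set x | ~ free_at g N x].
Proof.
pose O i := [set x | E i !=set0 /\ forall t, E i t -> r t = orb g x].
apply: (@sub_finite_set _ _ (\bigcup_i O i)).
  move=> x nfx; have [t rt] := fibre_neq0 x.
  have [i Eit [_ /constant_on_eq[u ru]]] := fibre_nonfree nfx rt.
  exists i => //; split; first by exists t.
  by move=> s Es; rewrite (ru s) // -rt (ru t).
apply: bigcup_finite => [|i _]; first exact: finite_finset.
have [[x [[t Et] rx]]|no] := pselect (exists x, O i x); last first.
  by rewrite (_ : O i = set0) // -subset0 => x Ox; apply: no; exists x.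
apply: (@sub_finite_set _ _ (orb g x)); last exact: orb_finite N0 gN _.
by move=> y [_ ry]; rewrite -(rx t Et) (ry t Et); apply: orb_refl.
Qed.
(** A curve lying over finitely many orbits but different from every [E i] would be finite: over a
    free orbit it has at most one point, and over a nonfree one it lies in the finite sets where it
    meets the exceptional curves. *)
Lemma curve_over_finite (D : set (pt T)) (F : set (pt S)) :
  curve T D -> finite_set F ->
  (forall t, D t -> exists2 x, F x & r t = orb g x) ->
  exists i, D = E i.
Proof.
move=> cD finF DF; apply: contrapT => noE; apply: (curve_infinite laws cD).
apply: (@sub_finite_set _ _ (\bigcup_(x in F) [set t | D t /\ r t = orb g x])).
  by move=> t Dt; have [x Fx rt] := DF t Dt; exists x.
apply: bigcup_finite => // x _.
have [free|nfree] := pselect (free_at g N x).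
  have [t0 rt0] := fibre_neq0 x.
  apply: (@sub_finite_set _ _ [set t0]); last exact: finite_set1.
  by move=> t [_ rt]; apply: fibre_uniq free _ _.
apply: (@sub_finite_set _ _
    (\bigcup_(i in [set i | exceptional r (E i)]) (D `&` E i))).
  by move=> t [Dt rt]; have [i Eit exi] := fibre_nonfree nfree rt; exists i.
apply: bigcup_finite => [|i [cE _]]; first exact: finite_finset.
have neq : D <> E i by move=> DE; apply: noE; exists i.
by have [] := curve_meet laws cD cE neq.
Qed.

End FiniteExceptional.
End MinimalResolution.
End RationalMaps.

(** * Push-forward and pull-back along a rational quotient map *)

Section RationalQuotient.
Variables (R : realType) (G : geometry R) (laws : geometry_laws G).
Implicit Types S T U : surf G.

Lemma push_contracted S T (f : mor S T) (C : set (pt S)) :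
  curve S C -> finite_set (f @` C) -> push f (cls C) = 0.
Proof.
move=> cC fin; have [[_ //]|[cD _]] := push_curve laws f cC.
by case: (curve_infinite laws cD).
Qed.

Lemma push_curve_zspan S T (f : mor S T) (C : set (pt S)) B :
  curve S C -> (curve T (f @` C) -> B (f @` C)) ->
  zspan [set cls D | D in B] (push f (cls C)).
Proof.
move=> cC BfC; have [[_ ->]|[cD [d [_ -> _]]]] := push_curve laws f cC.
  by case: (zspan_subgroup [set cls D | D in B]).
apply: (is_subgroupMn d (zspan_subgroup _)).
by apply: sub_zspan; exists (f @` C) => //; apply: BfC.
Qed.

Section QuotientMap.
Variables (S T : surf G) (g : mor S S) (N : nat) (r : pt T -> set (pt S)).
Hypotheses (N0 : (0 < N)%N) (gN : forall x, iter N g x = x).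
Implicit Type q : quotient_map g r.

Definition rpull q (y : H2 T) : H2 S := push (down q) (pull (up q) y).

Lemma rpushD q : {morph rpush q : x y / x + y}.
Proof. by move=> x y; rewrite /rpush (pullD laws) (pushD laws). Qed.

Lemma cup_rpush q x y : cup (rpush q x) y = cup x (rpull q y).
Proof.
rewrite /rpush /rpull (projection_formula laws) (cupC laws x).
by rewrite (projection_formula laws) (cupC laws).
Qed.

(** All components of the pull-back of [C] to the middle surface lie over one orbit, which is
    finite, so [down q] contracts them. *)
Lemma rpull_contracted q C : exceptional r C -> rpull q (cls C) = 0.
Proof.
move=> [cC /constant_on_eq[O rC]]; rewrite /rpull.
have [k [D [c [DC ->]]]] := pull_curve laws (deg_up q) cC.
rewrite (morphD_sum (pushD laws _)) big1 // => i _.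
rewrite (morphDMn (pushD laws _)); have [cD subD] := DC i.
rewrite push_contracted ?mul0rn //.
have [s0 Ds0] := curve_neq0 laws cD.
apply: sub_finite_set (orb_finite N0 gN (down q s0)) => _ [s Ds <-].
rewrite -quotient_mapE (rC _ (subD _ Ds0)) -(rC _ (subD _ Ds)) quotient_mapE.
exact: orb_refl.
Qed.

Lemma push_up_exceptional q C :
  curve (mid q) C -> constant_on (down q) C ->
  zspan [set cls D | D in exceptional r] (push (up q) (cls C)).
Proof.
move=> cC /constant_on_eq[x dC]; apply: push_curve_zspan => // cD; split=> //.
apply: (@constant_onP _ _ _ _ _ _ (orb g x)); first exact: curve_neq0 cD.
by move=> _ [s Cs <-]; rewrite quotient_mapE dC.
Qed.

(** The error of replacing a class upstairs by the pull-back of its push-forward along the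
    bimeromorphic [down q] is a sum of curves contracted by [down q]. Their images under [up q] lie
    over one orbit each, hence are exceptional or points. *)
Lemma rpush_rpull q y :
  zspan [set cls D | D in exceptional r]
    (rpush q (rpull q y) - y *+ deg (up q)).
Proof.
set a := pull (up q) y.
have -> : rpush q (rpull q y) - y *+ deg (up q)
    = push (up q) (pull (down q) (push (down q) a) - a).
  by rewrite (morphDB (pushD laws _)) (push_pull laws).
apply: (zspan_morph (pushD laws (up q)) (zspan_subgroup _)); last first.
  apply: (bimeromorphic_kernel laws (deg_down q)).
  by rewrite (morphDB (pushD laws _)) (push_pull laws) deg_down mulr1n subrr.
by move=> _ [C [cC dC] <-]; apply: push_up_exceptional.
Qed.

(* Dominate both resolutions of the indeterminacies by a third one: the two lifts
   to T agree where the fibre of r is a single point, hence everywhere. *)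
Lemma rpush_unique (q q' : quotient_map g r) :
  min_resolution g N r -> finite_set [set x | ~ free_at g N x] ->
  rpush q =1 rpush q'.
Proof.
move=> res fin.
have deg0 : (0 < deg (down q))%N by rewrite deg_down.
have [W [c [e [degc ce]]]] := domination laws deg0 (deg_down q').
have dege : deg e = 1%N.
  have := congr1 (fun h => deg h) ce; rewrite !(deg_comp laws) !deg_down degc.
  by rewrite !mul1n.
have de s : down q' (e s) = down q (c s).
  by rewrite -!(ev_comp laws) ce.
have deg_dc : (0 < deg (compm (down q) c))%N.
  by rewrite (deg_comp laws) deg_down degc.
have ue : compm (up q) c = compm (up q') e.
  apply: (identity_principle laws
    (thin_preimage laws deg_dc (thin_finite fin))) => s /contrapT.
  rewrite !(ev_comp laws) => free; apply: (fibre_uniq res free).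
    exact: quotient_mapE.
  by rewrite quotient_mapE de.
move=> x; rewrite /rpush -[pull (down q) x]mulr1n -degc -(push_pull laws).
rewrite -[pull (down q') x]mulr1n -dege -(push_pull laws).
by rewrite -!(push_comp laws) -!(pull_comp laws) ue ce.
Qed.

End QuotientMap.
End RationalQuotient.

(** * Automorphisms, quotients by involutions and towers of quotients *)

Lemma card_eq1 (T : Type) (A : set T) : A #= `I_1 -> exists x, A = [set x].
Proof.
move=> /eq_cardSP[x Ax]; rewrite II0 card_eq0 => /eqP Ax0; exists x.
apply/seteqP; split=> [y Ay|_ -> //]; apply: contrapT => yx.
by have : (A `\ x) y by []; rewrite Ax0.
Qed.

Lemma card_eq2 (T : Type) (A : set T) x y :
  x <> y -> A = [set x; y] -> A #= `I_2.
Proof.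
move=> xy ->; apply/eq_cardSP; exists x; first by left.
rewrite (_ : _ `\ x = [set y]) ?card_set1 //; apply/seteqP; split=> z /=.
  by case=> [[]].
by move=> ->; split; [right|move=> yx; apply: xy].
Qed.

Section Quotients.
Variables (R : realType) (G : geometry R) (laws : geometry_laws G).
Implicit Types S T U : surf G.

(** Composing [down q] with [g] does not change orbits, so it gives a second resolution of the same
    rational quotient map; the push-forward does not depend on the resolution. *)
Lemma rpush_aut S T (g : mor S S) N (r : pt T -> set (pt S))
    (q : quotient_map g r) x :
  has_order g N -> min_resolution g N r ->
  finite_set [set x | ~ free_at g N x] -> rpush q (pull g x) = rpush q x.
Proof.
move=> gN res fin; have [N0 _ _] := gN.
have deg_gd : deg (compm g (down q)) = 1%N.
  by rewrite (deg_comp laws) (has_order_deg laws gN) deg_down.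
have orb_gd s : r (up q s) = orb g (compm g (down q) s).
  rewrite quotient_mapE (ev_comp laws).
  by rewrite (orb_iter N0 (has_order_iter laws gN) 1).
pose q' := QuotientMap deg_gd (deg_up q) orb_gd.
rewrite [RHS](rpush_unique laws q q' res fin).
by rewrite /rpush /= (pull_comp laws).
Qed.

Lemma iter_invol (T : Type) (g : T -> T) k x :
  iter 2 g x = x -> iter k g x = x \/ iter k g x = g x.
Proof.
move=> g2; elim: k => [|k [IH|IH]] /=; first by left.
  by right; rewrite IH.
by left; rewrite IH.
Qed.

(** Take a generic [s] and let [z] be its image in [S]. Since [down q] is injective over generic
    points, the fibre of [up q] through [s] consists of the one point over [z] and the one over
    [g z]. *)
Lemma deg_involution_quotient S T (g : mor S S) (r : pt T -> set (pt S))
    (q : quotient_map g r) :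
  has_order g 2 -> min_resolution g 2 r ->
  finite_set [set x | ~ free_at g 2 x] -> deg (up q) = 2%N.
Proof.
move=> g2 res fin.
have gg x : g (g x) = x by exact: (has_order_iter laws g2).
have degg := has_order_deg laws g2.
have [A thinA fibA] := deg_fibre laws (up q).
have [B thinB fibB] := deg_fibre laws (down q).
have degd0 : (0 < deg (down q))%N by rewrite deg_down.
have deggd0 : (0 < deg (compm g (down q)))%N.
  by rewrite (deg_comp laws) degg deg_down.
pose bad := up q @^-1` A `|` (down q @^-1` B
  `|` (compm g (down q) @^-1` B
  `|` down q @^-1` [set x | ~ free_at g 2 x])).
have thin_bad : thin bad.
  by do ?apply: thinU; apply: (thin_preimage laws) => //;
    [exact: deg_up|apply: thin_finite].
(* If every point were bad, the identity principle would apply vacuously and give [g] composed with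
   [down q] equal to [down q]. Since [down q] is onto off the thin set [B], [g] would be the
   identity, against its order being 2. *)
have [s good] : exists s, ~ bad s.
  apply: contrapT => all_bad; have [_ _ /(_ 1%N isT)] := g2; apply.
  have gd : compm g (down q) = down q.
    apply: (identity_principle laws thin_bad) => s nbad.
    by case: all_bad; exists s.
  apply: (identity_principle laws thinB) => x nBx.
  have := fibB x nBx; rewrite deg_down => /card_eq1[s ds].
  have dsx : down q s = x by have : [set s] s by []; rewrite -ds.
  by rewrite (mor_powE laws) (ev_id laws) /= -{1}dsx -(ev_comp laws) gd.
set z := down q s; set t := up q s.
have free : free_at g 2 z by apply: contrapT => nf; apply: good; do 3 right.
have /card_eq1[s1 ds1] : down q @^-1` [set z] #= `I_1.
  by rewrite -(deg_down q); apply: fibB => Bz; apply: good; right; left.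
have /card_eq1[s2 ds2] : down q @^-1` [set g z] #= `I_1.
  rewrite -(deg_down q); apply: fibB => Bz; apply: good; right; right; left.
  by rewrite /= (ev_comp laws).
have ds1z : down q s1 = z by have : [set s1] s1 by []; rewrite -ds1.
have ds2z : down q s2 = g z by have : [set s2] s2 by []; rewrite -ds2.
have fibt : up q @^-1` [set t] #= `I_2.
  apply: (@card_eq2 _ _ s1 s2) => [s12|].
    by apply: (free 1%N isT); rewrite /= -ds2z -s12.
  have rt : r t = orb g z by exact: quotient_mapE.
  apply/seteqP; split=> [u ut|u]; last first.
    move=> us; apply: (fibre_uniq res free) => //; rewrite quotient_mapE.
    by case: us => ->; rewrite ?ds1z // ds2z (@orb_iter _ _ _ g 2 isT gg 1).
  have [k uk] : orb g z (down q u).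
    by rewrite -rt -ut quotient_mapE; apply: orb_refl.
  have [uz|uz] := iter_invol k (gg z); [left|right].
    by rewrite -ds1 /= uk uz.
  by rewrite -ds2 /= uk uz.
have tA : ~ A t by move=> At; apply: good; left.
apply/card_eq_II; apply: card_eq_trans fibt.
by rewrite card_eq_sym; apply: fibA.
Qed.

Section Tower.
Variables (X Z Y : surf G) (tau : mor X X) (tauh : mor Z Z).
Variables (rZ : pt Z -> set (pt X)) (rY : pt Y -> set (pt X)).
Variable rZY : pt Y -> set (pt Z).
Hypothesis tauhE : forall t, rZ (tauh t) = tau @` rZ t.
Hypothesis rZYE : forall t, rY t = \bigcup_(s in rZY t) rZ s.

Lemma tower_iter k z : rZ (iter k tauh z) = iter k tau @` rZ z.
Proof.
elim: k => [|k IH] /=; first by rewrite image_id.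
by rewrite tauhE IH image_comp.
Qed.

(** Along the [tauh]-orbit of [z] the values of [rZ] are the translates by powers of [tau] of one
    orbit of [tau] squared, and these translates fill the [tau]-orbit of [x]. *)
Lemma tower_orb t z x :
  rZY t = orb tauh z -> rZ z = orb (compm tau tau) x -> rY t = orb tau x.
Proof.
move=> tz zx; rewrite rZYE tz; apply/seteqP; split=> [y [_ [k ->]]|_ [k ->]].
  rewrite tower_iter zx => -[_ [l ->] <-]; exists (k + l.*2)%N.
  rewrite iterD; congr iter; elim: l => [|l IH] //=.
  by rewrite (ev_comp laws) IH.
exists (iter k tauh z); first by exists k.
by rewrite tower_iter; exists x => //; rewrite zx; apply: orb_refl.
Qed.

(* Pulling back along a bimeromorphic map commutes with push-forward up to classes
   of contracted curves. *)
Lemma tower_rpush (pi2 : quotient_map (compm tau tau) rZ)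
    (pi2h : quotient_map tauh rZY) :
  exists q : quotient_map tau rY, forall x,
    zspan [set cls D | D in exceptional rZY]
      (rpush pi2h (rpush pi2 x) - rpush q x).
Proof.
have [W [c [e [degc ce]]]] := domination laws (deg_up pi2) (deg_down pi2h).
have dege : (0 < deg e)%N.
  have := congr1 (fun h => deg h) ce; rewrite !(deg_comp laws) !deg_down degc.
  by rewrite mul1n muln1 => ->; apply: deg_up.
have cE s : down pi2h (e s) = up pi2 (c s) by rewrite -!(ev_comp laws) ce.
have deg_dc : deg (compm (down pi2) c) = 1%N.
  by rewrite (deg_comp laws) deg_down degc.
have deg_ue : (0 < deg (compm (up pi2h) e))%N.
  by rewrite (deg_comp laws) muln_gt0 deg_up.
have orbE s : rY (compm (up pi2h) e s) = orb tau (compm (down pi2) c s).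
  rewrite !(ev_comp laws); apply: (@tower_orb _ (down pi2h (e s))).
    exact: quotient_mapE.
  by rewrite cE quotient_mapE.
exists (QuotientMap deg_dc deg_ue orbE) => x.
rewrite /rpush /= (push_comp laws) (pull_comp laws) -(morphDB (pushD laws _)).
set a := pull (down pi2) x.
apply: (zspan_morph (pushD laws (up pi2h)) (zspan_subgroup _)); last first.
  apply: (bimeromorphic_kernel laws (deg_down pi2h)).
  rewrite (morphDB (pushD laws _)) (push_pull laws) deg_down mulr1n.
  by rewrite -(push_comp laws) ce (push_comp laws) (push_pull laws) degc subrr.
by move=> _ [D [cD dD] <-]; apply: (push_up_exceptional laws).
Qed.

End Tower.
End Quotients.

(** * The lattice spanned by four A_3 configurations and two isolated curves *)

Lemma sum_ord3 (V : nmodType) (F : 'I_3 -> V) :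
  \sum_j F j = F (inord 0) + F (inord 1) + F (inord 2).
Proof.
rewrite !big_ord_recl big_ord0 addr0 addrA.
by congr (F _ + F _ + F _); apply: val_inj; rewrite /= inordK.
Qed.

Lemma ord3_ind (Q : 'I_3 -> Prop) :
  Q (inord 0) -> Q (inord 1) -> Q (inord 2) -> forall j, Q j.
Proof.
move=> Q0 Q1 Q2 j; rewrite -(inord_val j).
by case: j => -[|[|[|]]].
Qed.

Lemma A3E (j l : nat) : (j < 3)%N -> (l < 3)%N -> A3 (inord j) (inord l) =
  if j == l then -2 else if (j == 1%N) || (l == 1%N) then 1 else 0.
Proof. by move=> j3 l3; rewrite /A3 -val_eqE /= !inordK. Qed.

Section Folding.
Variables (R : realType) (G : geometry R) (laws : geometry_laws G).
Variables (Z Y : surf G) (n : 'I_8 -> H2 Z).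
Variables (m : 'I_4 -> 'I_3 -> H2 Y) (mt : 'I_2 -> H2 Y).
Hypothesis n_gram : forall i j, cup (n i) (n j) = if i == j then -2 else 0.
Hypothesis m_gram : forall i i' j j',
  cup (m i j) (m i' j') = if i == i' then A3 j j' else 0.
Hypothesis mt_gram : forall k k',
  cup (mt k) (mt k') = if k == k' then -2 else 0.
Hypothesis m_mt_gram : forall i j k, cup (m i j) (mt k) = 0.

Definition exc (x : 'I_4 * 'I_3 + 'I_2) : H2 Y :=
  match x with inl p => m p.1 p.2 | inr k => mt k end.

Implicit Type c : 'I_4 * 'I_3 + 'I_2 -> int.

Definition exc_comb c : H2 Y := \sum_x exc x *~ c x.

Definition mcoef c i j : int := c (inl (i, inord j)).

Lemma cup_m_comb c i j :
  cup (m i j) (exc_comb c) = \sum_l A3 j l * c (inl (i, l)).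
Proof.
rewrite /exc_comb (cup_sumr laws) big_sumType /= [X in _ + X]big1 ?addr0.
  pose F i' l := if i == i' then A3 j l * c (inl (i', l)) else 0.
  transitivity (\sum_p F p.1 p.2).
    apply: eq_bigr => -[i' l] _; rewrite (cupMzr laws) m_gram /F /=.
    by case: eqP => // _; rewrite mul0r.
  rewrite -(pair_bigA _ F) (bigD1 i) //= [X in _ + X]big1 ?addr0.
    by apply: eq_bigr => l _; rewrite /F eqxx.
  by move=> i' /negPf i'i; apply: big1 => l _; rewrite /F eq_sym i'i.
by move=> k _; rewrite (cupMzr laws) m_mt_gram mul0r.
Qed.

Lemma cup_mt_comb c k : cup (mt k) (exc_comb c) = -2 * c (inr k).
Proof.
rewrite /exc_comb (cup_sumr laws) big_sumType /= big1 ?add0r => [|p _].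
  rewrite (bigD1 k) //= big1 ?addr0 => [|l /negPf lk].
    by rewrite (cupMzr laws) mt_gram eqxx.
  by rewrite (cupMzr laws) mt_gram eq_sym lk mul0r.
by rewrite (cupMzr laws) (cupC laws) m_mt_gram mul0r.
Qed.

Lemma cup_m_combE c i :
  [/\ cup (m i (inord 0)) (exc_comb c) = -2 * mcoef c i 0 + mcoef c i 1,
      cup (m i (inord 1)) (exc_comb c)
        = mcoef c i 0 - 2 * mcoef c i 1 + mcoef c i 2
    & cup (m i (inord 2)) (exc_comb c) = mcoef c i 1 - 2 * mcoef c i 2].
Proof. by rewrite !cup_m_comb !sum_ord3 !A3E //= /mcoef; split; lia. Qed.

(** The hypothesis makes every term of the self-intersection of [exc_comb c] vanish, and A_3 and A_1
    are negative definite. The proof solves the linear systems one configuration at a time. *)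
Lemma exc_comb_definite c :
  (forall x, c x = 0 \/ cup (exc x) (exc_comb c) = 0) -> forall x, c x = 0.
Proof.
move=> c0 [[i j]|k]; last first.
  by have /= := c0 (inr k); rewrite cup_mt_comb; lia.
have [E0 E1 E2] := cup_m_combE c i.
have := c0 (inl (i, inord 0)); have := c0 (inl (i, inord 1)).
have := c0 (inl (i, inord 2)); rewrite /= E0 E1 E2 -!/(mcoef c i _) => h2 h1 h0.
by elim/ord3_ind: j; rewrite -/(mcoef c i _); lia.
Qed.

Lemma zspan_excE x : zspan (range exc) x -> exists c, x = exc_comb c.
Proof. by move=> /zspan_family[c _ ->]; exists c. Qed.

Lemma zspan_exc_orth x :
  zspan (range exc) x -> (forall y, cup (exc y) x = 0) -> x = 0.
Proof.
move=> /zspan_excE[c ->] c0; apply: big1 => y _.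
by rewrite exc_comb_definite ?mulr0z // => z; right.
Qed.

Definition component (x : 'I_4 * 'I_3 + 'I_2) : 'I_4 + 'I_2 :=
  match x with inl p => inl p.1 | inr k => inr k end.

Definition middle (u : 'I_4 + 'I_2) : 'I_4 * 'I_3 + 'I_2 :=
  match u with inl i => inl (i, inord 1) | inr k => inr k end.

(** In the rational span of the curves this is -2 times the dual basis vector of the curve
    [middle u]. *)
Definition folded (u : 'I_4 + 'I_2) : H2 Y :=
  match u with
  | inl i => m i (inord 0) + m i (inord 1) *+ 2 + m i (inord 2)
  | inr k => mt k
  end.

Lemma cup_exc_far x y : component x <> component y -> cup (exc x) (exc y) = 0.
Proof.
case: x y => [[i j]|k] [[i' j']|k'] /= xy.
- by rewrite m_gram; case: eqP => // ii'; case: xy; rewrite ii'.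
- exact: m_mt_gram.
- by rewrite (cupC laws) m_mt_gram.
- by rewrite mt_gram; case: eqP => // kk'; case: xy; rewrite kk'.
Qed.

Lemma cup_comb_local c d x :
  (forall y, component y = component x -> c y = d y) ->
  cup (exc x) (exc_comb c) = cup (exc x) (exc_comb d).
Proof.
case: x => [[i j]|k] cd /=; last by rewrite !cup_mt_comb cd.
by rewrite !cup_m_comb; apply: eq_bigr => l _; rewrite cd.
Qed.

Lemma cup_folded x u :
  cup (exc x) (folded u) = if x == middle u then -2 else 0.
Proof.
case: u => [i|k]; last first.
  case: x => [p|l] /=; first by rewrite m_mt_gram.
  by rewrite mt_gram -[inr _ == _]/(l == k).
rewrite /folded !(cupDr laws).
case: x => [[i' j]|l]; last by rewrite /= !(cupC laws (mt l)) !m_mt_gram.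
rewrite /= !m_gram -[inl _ == _]/((i', j) == (i, inord 1)) xpair_eqE.
case: eqP => // _; elim/ord3_ind: j; rewrite !A3E //= -val_eqE /= !inordK //.
Qed.

Lemma zspan_folded u : zspan (range exc) (folded u).
Proof.
have sub := zspan_subgroup (range exc).
have gen x : zspan (range exc) (exc x) by apply: sub_zspan; exists x.
case: u => [i|k]; last exact: gen (inr k).
apply: (is_subgroupD sub (is_subgroupD sub _ _)).
- exact: gen (inl (i, _)).
- by apply: (is_subgroupMn 2 sub); apply: gen (inl (i, _)).
- exact: gen (inl (i, _)).
Qed.

(** * Images of disjoint (-2)-curves under a correspondence of degree 2 *)

Section Correspondence.
Variables (P : H2 Z -> H2 Y) (Q : H2 Y -> H2 Z) (K : set ('I_4 * 'I_3 + 'I_2)).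
Hypothesis adj : forall x y, cup (P x) y = cup x (Q y).
Hypothesis K_ker : forall x, K x -> Q (exc x) = 0.
Hypothesis PQ : forall x,
  zspan [set exc y | y in K] (P (Q (exc x)) - exc x *+ 2).
Hypothesis Q_eff : forall x, exists q : 'I_8 -> nat,
  Q (exc x) = \sum_a n a *+ q a.
Hypothesis P_n : forall a, zspan (range exc) (P (n a)).

(** Each [Q (exc x)] is a nonnegative vector in the n's. These vectors vanish for outer curves, have
    entries at most 1 for middle ones, and have disjoint supports for different components; so [n a]
    occurs in at most one of them, which determines [P (n a)] by nondegeneracy. *)
Lemma folding a : P (n a) = 0 \/ exists u, P (n a) = folded u.
Proof.
have [q qE] := choice Q_eff.
(* [g] is the Gram matrix of the vectors [Q (exc x)] divided by -2. It is also minus the pairing of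
   x with the projection of y away from [K], and it consists of natural numbers. *)
pose g x y := (\sum_b q x b * q y b)%N.
have cupQ x b : cup (Q (exc x)) (n b) = -2 * (q x b)%:Z.
  rewrite (cupC laws) qE (cup_sumr laws) (bigD1 b) //= big1 ?addr0.
    by rewrite (cupMnr laws) n_gram eqxx; lia.
  by move=> b' /negPf b'b; rewrite (cupMnr laws) n_gram eq_sym b'b mul0rn.
have gE x y : cup (exc x) (P (Q (exc y))) = -2 * (g x y)%:Z.
  rewrite (cupC laws) adj (cupC laws) [X in cup _ X]qE (cup_sumr laws).
  rewrite /g (big_morph Posz PoszD (erefl _)) mulr_sumr; apply: eq_bigr => b _.
  by rewrite (cupMnr laws) cupQ; lia.
have gC x y : g x y = g y x by apply: eq_bigr => b _; rewrite mulnC.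
have gK x y : K x -> g x y = 0%N.
  move=> Kx; have := gE x y.
  by rewrite (cupC laws) adj (K_ker Kx) (cup0r laws); lia.
have /choice[c cP] : forall y, exists c, (forall x, ~ K x -> c x = 0) /\
    P (Q (exc y)) = exc y *+ 2 + exc_comb c.
  move=> y; have [c c0 PQc] := zspan_family (PQ y).
  by exists c; split=> //; rewrite /exc_comb -PQc addrC subrK.
have gc x y : -2 * (g x y)%:Z = cup (exc x) (exc y) *+ 2
    + cup (exc x) (exc_comb (c y)).
  by rewrite -gE (cP y).2 (cupDr laws) (cupMnr laws).
have g_far x y : component x <> component y -> g x y = 0%N.
  (* [d] is the part of the correction [c y] in the component of [x]. It is orthogonal to the
     contracted curves there, since [exc y] does not meet that component, and definiteness kills
     it. *)
  move=> xy; pose d z := if component z == component x then c y z else 0.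
  have d0 : forall z, d z = 0.
    apply: exc_comb_definite => z; rewrite /d.
    case: eqP => [zx|]; last by left.
    have [Kz|nKz] := pselect (K z); last by left; apply: (cP y).1.
    right; have := gc z y; rewrite gK // cup_exc_far ?zx // mul0rn add0r => /esym.
    by rewrite (cup_comb_local (d := d)) // => w wz; rewrite /d wz zx eqxx.
  have := gc x y; rewrite cup_exc_far // mul0rn add0r.
  rewrite (cup_comb_local (d := d)) => [|w wx]; last by rewrite /d wx eqxx.
  by rewrite /exc_comb big1 ?(cup0r laws) => [|w _]; rewrite ?d0 ?mulr0z //; lia.
have q_le x b : (q x b * q x b <= g x x)%N by rewrite /g (bigD1 b) //= leq_addr.
have g_disj x y b : g x y = 0%N -> (q x b * q y b = 0)%N.
  by move/eqP; rewrite sum_nat_eq0 => /forallP/(_ b)/eqP.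
(* Of the eight possible sets of contracted curves in an A_3, only the two outer curves and all
   three curves leave [g] with nonnegative integral entries. *)
have g_block i : [/\ g (inl (i, inord 0)) (inl (i, inord 0)) = 0%N,
    g (inl (i, inord 2)) (inl (i, inord 2)) = 0%N
    & (g (inl (i, inord 1)) (inl (i, inord 1)) <= 1)%N].
  pose x j : 'I_4 * 'I_3 + 'I_2 := inl (i, inord j).
  have e j l : (j < 3)%N -> (l < 3)%N -> cup (exc (x j)) (exc (x l)) =
      if j == l then -2 else if (j == 1%N) || (l == 1%N) then 1 else 0.
    by move=> j3 l3; rewrite /= m_gram eqxx A3E.
  have r l := cup_m_combE (c (x l)) i.
  have k j : (forall l, g (x j) l = 0%N) \/
      (forall l, mcoef (c (x l)) i j = 0).
    have [Kj|nKj] := pselect (K (x j)); [by left=> l; apply: gK|right=> l].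
    exact: (cP (x l)).1.
  have := gC (x 1%N) (x 0%N); have := gC (x 2%N) (x 0%N).
  have := gC (x 2%N) (x 1%N).
  have [r00 r10 r20] := r 0%N; have [r01 r11 r21] := r 1%N.
  have [r02 r12 r22] := r 2%N.
  have := gc (x 0%N) (x 0%N); have := gc (x 0%N) (x 1%N).
  have := gc (x 0%N) (x 2%N); have := gc (x 1%N) (x 1%N).
  have := gc (x 1%N) (x 2%N); have := gc (x 2%N) (x 2%N).
  have := gc (x 1%N) (x 0%N); have := gc (x 2%N) (x 0%N).
  have := gc (x 2%N) (x 1%N).
  rewrite !e //= r00 r01 r02 r10 r11 r12 r20 r21 r22 -!/(x _).
  have k3 j : [/\ g (x j) (x 0%N) = 0%N, g (x j) (x 1%N) = 0%N
      & g (x j) (x 2%N) = 0%N] \/ [/\ mcoef (c (x 0%N)) i j = 0,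
      mcoef (c (x 1%N)) i j = 0 & mcoef (c (x 2%N)) i j = 0].
    by have [k0|k0] := k j; [left|right]; rewrite !k0.
  have [[]|[]] := k3 0%N; have [[]|[]] := k3 1%N; have [[]|[]] := k3 2%N;
    by clear=> *; split; lia.
have g_mt k : (g (inr k) (inr k) <= 2)%N.
  have := gc (inr k) (inr k); rewrite cup_mt_comb /= mt_gram eqxx.
  have [Kk|nKk] := pselect (K (inr k)); first by rewrite gK.
  by rewrite (cP _).1 //; lia.
(* A natural number whose square is at most 2 is at most 1. *)
have q_mid u b : (q (middle u) b <= 1)%N.
  have := q_le (middle u) b; case: u => [i|k] /=.
    by have [_ _] := g_block i; nia.
  by have := g_mt k; nia.
have q_side i j b : j != inord 1 -> q (inl (i, j)) b = 0%N.
  have [g0 g2 _] := g_block i.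
  have := q_le (inl (i, j)) b; elim/ord3_ind: j => [||]; last 1 first.
  - by rewrite g2 => ? _; nia.
  - by rewrite g0 => ? _; nia.
  - by rewrite eqxx.
have q_far u x b : q (middle u) b != 0%N -> x != middle u -> q x b = 0%N.
  move=> qu xu; have [xu'|/g_far/(g_disj _ _ b)] :=
    pselect (component x = component (middle u)).
    case: x u xu xu' {qu} => [[i j]|k] [i'|k'] //= xu [ii'].
      by apply: q_side; apply: contra xu; rewrite ii' => /eqP ->.
    by rewrite ii' eqxx in xu.
  by move/eqP; rewrite muln_eq0 (negPf qu) orbF => /eqP.
have cupP x b : cup (exc x) (P (n b)) = -2 * (q x b)%:Z.
  by rewrite (cupC laws) adj (cupC laws).
(* If [n a] occurs in the image of [middle u], it does so with coefficient 1 and in no other image,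
   so [P (n a)] and [folded u] meet all curves equally. Otherwise [P (n a)] is orthogonal to all
   curves. *)
have [[u qu]|no] := pselect (exists u, q (middle u) a != 0%N); [right|left].
  exists u; apply/eqP; rewrite -subr_eq0; apply/eqP; apply: zspan_exc_orth.
    by apply: (zspan_subgroup _).2 => //; apply: zspan_folded.
  move=> x; rewrite (cupBr laws) cupP cup_folded.
  have [->|xu] := eqVneq x (middle u); last by rewrite (q_far u).
  by have := q_mid u a; lia.
apply: zspan_exc_orth => // x; rewrite cupP.
have -> : q x a = 0%N => //.
have q0 u : q (middle u) a = 0%N.
  by apply/eqP/negPn/negP => qu; apply: no; exists u.
case: x => [[i j]|k]; last exact: q0 (inr k).
by have [->|/q_side //] := eqVneq j (inord 1); apply: q0 (inl i).
Qed.
End Correspondence.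

End Folding.

(** * The push-forward annihilates coinvariant classes *)

Section Coinvariants.
Variables (R : realType) (G : geometry R) (laws : geometry_laws G).
Variables (S T : surf G) (g : mor S S) (N : nat) (r : pt T -> set (pt S)).
Variable q : quotient_map g r.
Hypotheses (gN : has_order g N) (res : min_resolution g N r).
Hypothesis fin : finite_set [set x | ~ free_at g N x].

(** Any class [w] is a pull-back under [g], which preserves the form. By adjointness the claim
    becomes the invariance of [rpush q] under [g]. *)
Lemma rpull_invariant y : pull g (rpull q y) = rpull q y.
Proof.
have [N0 _ _] := gN; apply: (cup_inj laws) => w.
have -> : w = pull g (pull (mor_pow g N.-1) w).
  rewrite -(pull_comp laws) (_ : compm _ g = idm S) ?(pull_id laws) //.
  apply: (mor_ext laws) => x; rewrite (ev_comp laws) (ev_id laws).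
  by rewrite (mor_powE laws) -iterSr prednK // (has_order_iter laws gN).
rewrite (cup_pull laws) (has_order_deg laws gN) mulr1n -!(cup_rpush laws).
by rewrite (rpush_aut laws q _ gN res fin).
Qed.

Lemma rpush_coinvariant x : coinvariant_lattice g x -> rpush q x = 0.
Proof.
move=> gx; apply: (cup_inj laws) => y; rewrite (cup0r laws) (cupC laws).
by rewrite (cup_rpush laws) gx // rpull_invariant.
Qed.

End Coinvariants.

(** * Exceptional curves along the tower X, Z, Y *)

Section TowerCurves.
Variables (R : realType) (G : geometry R) (laws : geometry_laws G).
Variables (X Z Y : surf G) (tau : mor X X) (tauh : mor Z Z).
Variables (rZ : pt Z -> set (pt X)) (rY : pt Y -> set (pt X)).
Variable rZY : pt Y -> set (pt Z).
Hypothesis tau4 : has_order tau 4.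
Hypothesis resZ : min_resolution (compm tau tau) 2 rZ.
Hypothesis tauhE : forall t, rZ (tauh t) = tau @` rZ t.
Hypothesis rZYE : forall t, rY t = \bigcup_(s in rZY t) rZ s.
Variable pi2h : quotient_map tauh rZY.

Lemma exceptional_tower C : exceptional rZY C -> exceptional rY C.
Proof.
move=> [cC /constant_on_eq[O rC]]; split=> //.
apply: (constant_onP (curve_neq0 laws cC)) => t /rC rt.
by rewrite rZYE rt.
Qed.

Lemma tower_up s x : rZ (down pi2h s) = orb (compm tau tau) x ->
  rY (up pi2h s) = orb tau x.
Proof.
by apply: (tower_orb laws tauhE rZYE); apply: quotient_mapE.
Qed.

(** The components of the pull-back of [C] lie over one orbit of [tau] squared, so their images in
    [Y] lie over one orbit of [tau]. *)
Lemma rpush_exceptional C : exceptional rZ C ->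
  zspan [set cls D | D in exceptional rY] (rpush pi2h (cls C)).
Proof.
move=> [cC /constant_on_eq[O rC]].
have sub := zspan_subgroup [set cls D | D in exceptional rY].
have deg0 : (0 < deg (down pi2h))%N by rewrite deg_down.
rewrite /rpush; have [k [D [c [DC ->]]]] := pull_curve laws deg0 cC.
rewrite (morphD_sum (pushD laws _)); apply: is_subgroup_sum => // i.
rewrite (morphDMn (pushD laws _)); apply: (is_subgroupMn _ sub).
have [cD subD] := DC i; apply: (push_curve_zspan laws cD) => cuD; split=> //.
have [s0 Ds0] := curve_neq0 laws cD.
have [x Ox] := mr_orbit resZ (down pi2h s0).
apply: (@constant_onP _ _ _ _ _ _ (orb tau x)).
  exact: (curve_neq0 laws cuD).
move=> _ [s Ds <-]; apply: tower_up.
by rewrite -Ox !rC //; apply: subD.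
Qed.

Variables (I : finType) (E : I -> set (pt Z)).
Hypothesis exE : forall C, exceptional rZ C -> exists i, C = E i.

(** A component of the pull-back of [C] is either contracted in [Z] or mapped onto a curve lying
    over a finite [tau]-orbit, which must be one of the [E i]. All multiplicities are natural
    numbers. *)
Lemma rpull_effective C : exceptional rY C ->
  exists q : I -> nat, rpull pi2h (cls C) = \sum_i cls (E i) *+ q i.
Proof.
move=> [cC /constant_on_eq[O rC]].
pose B := [set v : H2 Z | exists q : I -> nat, v = \sum_i cls (E i) *+ q i].
have B0 : B 0 by exists (fun=> 0%N); rewrite big1.
have BD u v : B u -> B v -> B (u + v).
  move=> [q1 ->] [q2 ->]; exists (fun i => q1 i + q2 i)%N.
  by rewrite -big_split; apply: eq_bigr => i _; rewrite mulrnDr.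
have BMn v k : B v -> B (v *+ k).
  by move=> Bv; elim: k => // k IH; rewrite mulrS; apply: BD.
rewrite /rpull; have [k [D [c [DC ->]]]] := pull_curve laws (deg_up pi2h) cC.
rewrite (morphD_sum (pushD laws _)); apply: (big_ind B) => // i _.
rewrite (morphDMn (pushD laws _)); apply: (BMn); have [cD subD] := DC i.
have [[_ ->] //|[cdD [d [_ -> _]]]] := push_curve laws (down pi2h) cD.
have gens i0 : B (cls (E i0)).
  exists (fun i => (i == i0) : nat); rewrite (bigD1 i0) //= eqxx mulr1n big1.
    by rewrite addr0.
  by move=> j /negPf ->; rewrite mulr0n.
apply: (BMn).
have tau0 : (0 < 4)%N by [].
have [s0 Ds0] := curve_neq0 laws cD.
have [x0 rx0] := mr_orbit resZ (down pi2h s0).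
have Ox0 : O = orb tau x0 by rewrite -(rC _ (subD _ Ds0)) (tower_up rx0).
have tau2 x : iter 2 (compm tau tau) x = x.
  by rewrite /= !(ev_comp laws); apply: (has_order_iter laws tau4).
have over t : (down pi2h @` D i) t ->
    exists2 x, orb tau x0 x & rZ t = orb (compm tau tau) x.
  move=> [s Ds <-]; have [x rx] := mr_orbit resZ (down pi2h s); exists x => //.
  by rewrite -Ox0 -(rC _ (subD _ Ds)) (tower_up rx); apply: orb_refl.
have finO := orb_finite tau0 (has_order_iter laws tau4) x0.
have [j ->] := curve_over_finite laws resZ exE cdD finO over.
exact: gens.
Qed.

End TowerCurves.

(** * A common indexing of the exceptional curves of Y *)

Section ExceptionalCurves.
Variables (R : realType) (G : geometry R).
Variables (X Y : surf G) (tau : mor X X) (mk : marking tau).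
Variables (rY : pt Y -> set (pt X)) (p : H2 X -> H2 Y).
Variable ny : numbering_Y mk rY p.

Definition exc_curve (x : 'I_4 * 'I_3 + 'I_2) : set (pt Y) :=
  match x with inl p => m_curve ny p.1 p.2 | inr k => mt_curve ny k end.

Notation excY := (exc (m_ ny) (mt_ ny)).

Lemma excYE x : excY x = cls (exc_curve x).
Proof. by case: x. Qed.

Lemma exceptional_exc C : exceptional rY C <-> exists x, C = exc_curve x.
Proof.
split=> [/(m_exceptional ny)[[i [j ->]]|[k ->]]|[[[i j]|k] ->]].
- by exists (inl (i, j)).
- by exists (inr k).
- by apply/(m_exceptional ny); left; exists i, j.
- by apply/(m_exceptional ny); right; exists k.
Qed.

End ExceptionalCurves.

(** * Congruences satisfied by the classes in M *)

Section Glue.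
Variables (R : realType) (G : geometry R) (laws : geometry_laws G).
Variables (X Y : surf G) (tau : mor X X) (mk : marking tau).
Variables (rY : pt Y -> set (pt X)) (p : H2 X -> H2 Y).
Variable ny : numbering_Y mk rY p.

Notation excY := (exc (m_ ny) (mt_ ny)).
Notation foldedY := (folded (m_ ny) (mt_ ny)).

(* On the span of the curves, phi i is -4 times the coefficient of m^(i+1)_1, as
   3 m_1 + 2 m_2 + m_3 is -4 times a dual basis vector of A_3. *)
Definition phi (i : nat) (x : H2 Y) : int :=
  cup (m_ ny (inord i) (inord 0)) x *+ 3
  + cup (m_ ny (inord i) (inord 1)) x *+ 2 + cup (m_ ny (inord i) (inord 2)) x.

Definition psi (k : nat) (x : H2 Y) : int := cup (mt_ ny (inord k)) x.

Lemma phiD i : {morph phi i : x y / x + y}.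
Proof. by move=> x y; rewrite /phi !(cupDr laws); lia. Qed.

Lemma psiD k : {morph psi k : x y / x + y}.
Proof. exact: cupDr. Qed.

Definition phiE := (phiD, fun i => morphDN (phiD i),
  fun i => morphDMn (phiD i), psiD, fun k => morphDN (psiD k),
  fun k => morphDMn (psiD k)).

Lemma phi_m i i' j : (i < 4)%N -> (i' < 4)%N -> (j < 3)%N ->
  phi i (m_ ny (inord i') (inord j))
    = if (i == i') && (j == 0%N) then -4 else 0.
Proof.
move=> i4 i'4 j3; rewrite /phi !(m_gram ny) -val_eqE /= !inordK //.
by case: eqP => // _; rewrite !A3E //; case: j j3 => [|[|[|]]].
Qed.

Lemma phi_mt i k : phi i (mt_ ny k) = 0.
Proof. by rewrite /phi !(m_mt_gram ny). Qed.

Lemma psi_m k i j : psi k (m_ ny i j) = 0.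
Proof. by rewrite /psi (cupC laws) (m_mt_gram ny). Qed.

Lemma psi_mt k k' : (k < 2)%N -> (k' < 2)%N ->
  psi k (mt_ ny (inord k')) = if k == k' then -2 else 0.
Proof.
by move=> k2 k'2; rewrite /psi (mt_gram ny) -val_eqE /= !inordK.
Qed.

Lemma sub_exceptional_lattice : zspan (range excY) `<=` exceptional_lattice ny.
Proof.
rewrite exceptional_latticeE; apply: zspan_mono => _ [x _ <-]; left.
exists (exc_curve ny x); last by rewrite excYE.
by apply/(exceptional_exc ny); exists x.
Qed.

(** On the curves [phi] takes values 0 and -4 and [psi] values 0 and -2, while all of them take the
    value -1 on the extra generator [mu]. *)
Lemma exceptional_lattice_parity w : exceptional_lattice ny w ->
  forall i k, (i < 4)%N -> (k < 2)%N -> exists s t : int,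
    phi i w = phi 0 w + s * 4 /\ psi k w = phi 0 w + t * 2.
Proof.
move=> Mw i k i4 k2; move: w Mw.
pose B := [set w | exists s t : int,
  phi i w = phi 0 w + s * 4 /\ psi k w = phi 0 w + t * 2].
rewrite exceptional_latticeE; apply: (zspan_min (B := B)).
  split=> [|x y [s [t [xs xt]]] [s' [t' [ys yt]]]].
    by exists 0, 0; rewrite /phi /psi !(cup0r laws).
  by exists (s - s'), (t - t'); rewrite !phiE; lia.
move=> w [[D /(exceptional_exc ny)[x ->] <-]|->].
  rewrite -excYE; case: x => [[i' j]|k'] /=.
    rewrite -(inord_val i') -(inord_val j); exists
      ((if (i == i') && (j == 0%N :> nat) then -1 else 0) -
       (if (0%N == i') && (j == 0%N :> nat) then -1 else 0)),
      (if (0%N == i') && (j == 0%N :> nat) then 2 else 0).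
    rewrite !phi_m ?psi_m //.
    by case: (i == i') (0%N == i' :> nat) (j == 0%N :> nat) => [] [] [].
  rewrite -(inord_val k'); exists 0, (if k == k' then -1 else 0).
  by rewrite !phi_mt psi_mt //; case: eqP.
(* The value of an additive functional at [mu] is read off from 4 [mu]. *)
have sum_mu (f : H2 Y -> int) : {morph f : x y / x + y} ->
    f (mu ny) * 4 = \sum_(a < 4) (f (m_ ny a (inord 0))
      + f (m_ ny a (inord 1)) * 2 + f (m_ ny a (inord 2)) * 3)
    + (f (mt_ ny (inord 0)) + f (mt_ ny (inord 1))) * 2.
  move=> fD; have := congr1 f (muE ny).
  rewrite (morphDMn fD) fD (morphD_sum fD) (morphDMn fD) fD.
  rewrite (eq_bigr (fun a => f (m_ ny a (inord 0))
      + f (m_ ny a (inord 1)) * 2 + f (m_ ny a (inord 2)) * 3)).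
    by move: (\sum_(_ < 4) _) => /=; lia.
  by move=> a _; rewrite fD fD !(morphDMn fD) /=; lia.
have mu_phi a : (a < 4)%N -> phi a (mu ny) = -1.
  move=> a4; have := sum_mu _ (phiD a).
  rewrite !phi_mt (bigD1 (inord a)) //= big1 => [|b ba].
    by rewrite !phi_m // eqxx /=; lia.
  rewrite -(inord_val b) !phi_m // (_ : (a == b) = false) //.
  by apply/eqP => ab; move: ba; rewrite ab inord_val eqxx.
have mu_psi : psi k (mu ny) = -1.
  have := sum_mu _ (psiD k); rewrite big1 => [|b _]; last by rewrite !psi_m.
  by rewrite !psi_mt //; case: eqP => ?; case: eqP => ?; lia.
by exists 0, 0; rewrite !mu_phi // mu_psi.
Qed.

Lemma phi_folded i u : (i < 4)%N ->
  phi i (foldedY u) = if u == inl (inord i) then -4 else 0.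
Proof.
move=> i4; rewrite /phi.
have cupf j := cup_folded laws (m_gram ny) (mt_gram ny) (m_mt_gram ny)
  (inl (inord i, inord j)) u.
rewrite !cupf; case: u {cupf} => [i'|k] //=.
rewrite -![inl (inord i, _) == _]/((inord i, inord _) == (i', inord 1)).
rewrite -[inl _ == _]/(i' == inord i) !xpair_eqE eq_sym -!val_eqE /= !inordK //.
by case: eqP.
Qed.

Lemma psi_folded k u : (k < 2)%N ->
  psi k (foldedY u) = if u == inr (inord k) then -2 else 0.
Proof.
move=> k2; rewrite /psi.
rewrite (cup_folded laws (m_gram ny) (mt_gram ny) (m_mt_gram ny)
  (inr (inord k)) u).
by case: u => [i'|l] //=; rewrite eq_sym.
Qed.
(** By primitivity the half [w] also lies in M, so the congruences for [w] hold for [x] with doubled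
    moduli. *)
Lemma parity_double w x : w *+ 2 = x -> exceptional_lattice ny x ->
  forall i k, (i < 4)%N -> (k < 2)%N -> exists s t : int,
    phi i x = phi 0 x + s * 8 /\ psi k x = phi 0 x + t * 4.
Proof.
move=> <- Mx i k i4 k2.
have [_ Mdiv] := primitive_closure_primitive [set cls C | C in exceptional rY].
have Mw : exceptional_lattice ny w by apply: (Mdiv 2%N).
have [s [t [phi_w psi_w]]] := exceptional_lattice_parity Mw i4 k2.
by exists s, t; rewrite !phiE; lia.
Qed.

(** Numeric codes for the seven possible values of the push-forward of an n: 0 for zero, 1 to 4 for
    the A_3 configurations and 5, 6 for the isolated curves. Finding the images becomes a finite
    search with linear arithmetic. *)
Definition coded : nat -> H2 Y := nth 0 [:: 0; foldedY (inl (inord 0));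
  foldedY (inl (inord 1)); foldedY (inl (inord 2)); foldedY (inl (inord 3));
  foldedY (inr (inord 0)); foldedY (inr (inord 1))].

Lemma codedP x : x = 0 \/ (exists u, x = foldedY u) ->
  exists2 c, (c < 7)%N & x = coded c.
Proof.
case=> [->|[[i|k] ->]]; first by exists 0%N.
  exists i.+1; first by case: i => i ? /=; lia.
  by rewrite -{1}(inord_val i); case: i => -[|[|[|[|]]]].
exists (k + 5)%N; first by case: k => k ? /=; lia.
by rewrite -{1}(inord_val k); case: k => -[|[|]].
Qed.

Lemma phi_coded i c : (i < 4)%N -> (c < 7)%N ->
  phi i (coded c) = if c == i.+1 then -4 else 0.
Proof.
have ord_eq (a b : nat) : (a < 4)%N -> (b < 4)%N ->
    (inl (inord a) == inl (inord b) :> 'I_4 + 'I_2) = (a == b).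
  move=> a4 b4; rewrite -[LHS]/(inord a == inord b :> 'I_4) -val_eqE /=.
  by rewrite !inordK.
move=> i4; case: c => [|[|[|[|[|[|[|]]]]]]] // _.
- by rewrite -[coded _]/(0 : H2 Y) /phi !(cup0r laws).
- by rewrite -[coded _]/(foldedY (inl (inord 0))) phi_folded // ord_eq.
- by rewrite -[coded _]/(foldedY (inl (inord 1))) phi_folded // ord_eq.
- by rewrite -[coded _]/(foldedY (inl (inord 2))) phi_folded // ord_eq.
- by rewrite -[coded _]/(foldedY (inl (inord 3))) phi_folded // ord_eq.
- rewrite -[coded _]/(foldedY (inr (inord 0))) phi_folded //=.
  by case: eqP => //; lia.
- rewrite -[coded _]/(foldedY (inr (inord 1))) phi_folded //=.
  by case: eqP => //; lia.
Qed.

Lemma psi_coded k c : (k < 2)%N -> (c < 7)%N ->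
  psi k (coded c) = if c == k + 5 :> nat then -2 else 0.
Proof.
have ord_eq (a b : nat) : (a < 2)%N -> (b < 2)%N ->
    (inr (inord a) == inr (inord b) :> 'I_4 + 'I_2) = (a == b).
  move=> a4 b4; rewrite -[LHS]/(inord a == inord b :> 'I_2) -val_eqE /=.
  by rewrite !inordK.
move=> k2; case: c => [|[|[|[|[|[|[|]]]]]]] // _.
- by rewrite -[coded _]/(0 : H2 Y) /psi (cup0r laws); case: k k2.
- by rewrite -[coded _]/(foldedY (inl (inord 0))) psi_folded //=; case: eqP; lia.
- by rewrite -[coded _]/(foldedY (inl (inord 1))) psi_folded //=; case: eqP; lia.
- by rewrite -[coded _]/(foldedY (inl (inord 2))) psi_folded //=; case: eqP; lia.
- by rewrite -[coded _]/(foldedY (inl (inord 3))) psi_folded //=; case: eqP; lia.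
- by rewrite -[coded _]/(foldedY (inr (inord 0))) psi_folded // ord_eq //;
    case: k k2 => [|[|]].
- by rewrite -[coded _]/(foldedY (inr (inord 1))) psi_folded // ord_eq //;
    case: k k2 => [|[|]].
Qed.

Lemma coded_in_lattice c : zspan (range excY) (coded c).
Proof.
case: c => [|[|[|[|[|[|[|c]]]]]]]; try exact: zspan_folded.
  by case: (zspan_subgroup (range excY)).
by rewrite /coded nth_default //; case: (zspan_subgroup (range excY)).
Qed.

End Glue.

(** * The push-forward of the exceptional curves of Z *)

Section Pushforward.
Variables (R : realType) (G : geometry R) (laws : geometry_laws G).
Variables (X Z Y : surf G) (tau : mor X X) (tauh : mor Z Z).
Variables (rZ : pt Z -> set (pt X)) (rY : pt Y -> set (pt X)).
Variable rZY : pt Y -> set (pt Z).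
Hypotheses (tau4 : has_order tau 4) (tauh2 : has_order tauh 2).
Hypothesis resZ : min_resolution (compm tau tau) 2 rZ.
Hypothesis resY : min_resolution tau 4 rY.
Hypothesis resZY : min_resolution tauh 2 rZY.
Hypothesis tauhE : forall t, rZ (tauh t) = tau @` rZ t.
Hypothesis rZYE : forall t, rY t = \bigcup_(s in rZY t) rZ s.
Variables (pi2 : quotient_map (compm tau tau) rZ) (pi4 : quotient_map tau rY).
Variables (pi2h : quotient_map tauh rZY) (mk : marking tau).
Variable nz : numbering_Z mk rZ (rpush pi2).
Variable ny : numbering_Y mk rY (rpush pi4).

Notation excY := (exc (m_ ny) (mt_ ny)).

Lemma exceptional_excZY C : exceptional rZY C -> exists x, C = exc_curve ny x.
Proof. by move=> /(exceptional_tower laws rZYE) /(exceptional_exc ny). Qed.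

Lemma tau_nonfree_finite : finite_set [set x | ~ free_at tau 4 x].
Proof.
apply: (nonfree_finite laws _ (has_order_iter laws tau4) resY
  (E := exc_curve ny)) => // C.
by move=> /(exceptional_exc ny).
Qed.

Lemma tauh_nonfree_finite : finite_set [set x | ~ free_at tauh 2 x].
Proof.
exact: (nonfree_finite laws _ (has_order_iter laws tauh2) resZY
  exceptional_excZY).
Qed.

Let contracted := [set x | exceptional rZY (exc_curve ny x)].

Lemma zspan_contracted :
  zspan [set cls D | D in exceptional rZY]
  `<=` zspan [set excY x | x in contracted].
Proof.
apply: zspan_mono => _ [D exD <-]; have [x Dx] := exceptional_excZY exD.
by exists x; rewrite /contracted /= ?excYE -Dx.
Qed.

Lemma rpull_contracted_exc x : contracted x -> rpull pi2h (excY x) = 0.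
Proof.
rewrite excYE; apply: (rpull_contracted laws _ (has_order_iter laws tauh2)).
by [].
Qed.

(** The two sides differ by a combination of contracted curves. Both are orthogonal to each
    contracted curve, because its pull-backs to [Z] and to [X] vanish, so the difference is 0 by
    definiteness. *)
Lemma rpush_tower x : rpush pi2h (rpush pi2 x) = rpush pi4 x.
Proof.
have [q qE] := tower_rpush laws tauhE rZYE pi2 pi2h.
have /zspan_contracted/zspan_family[c c0 dE] := qE x.
rewrite -(rpush_unique laws q pi4 resY tau_nonfree_finite).
apply/eqP; rewrite -subr_eq0 dE; apply/eqP/big1 => y _.
rewrite (exc_comb_definite laws (m_gram ny) (mt_gram ny) (m_mt_gram ny)).
  by rewrite mulr0z.
move=> z; have [Kz|nKz] := pselect (contracted z); last by left; apply: c0.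
right; rewrite /exc_comb -dE (cupBr laws) !(cupC laws (excY z)).
rewrite (cup_rpush laws) rpull_contracted_exc // (cup_rpush laws q) excYE.
rewrite (rpull_contracted laws _ (has_order_iter laws tau4)) //.
  by rewrite !(cup0r laws) subrr.
exact: (exceptional_tower laws rZYE Kz).
Qed.

Lemma rpush_n a : rpush pi2h (n_ nz a) = 0 \/
  exists u, rpush pi2h (n_ nz a) = folded (m_ ny) (mt_ ny) u.
Proof.
have exn i : exceptional rZ (n_curve nz i).
  by apply/(n_exceptional nz); exists i.
apply: (folding laws (n_gram nz) (m_gram ny) (mt_gram ny) (m_mt_gram ny)
  (Q := rpull pi2h) (K := contracted)) => [x y|x|x|x|{}a].
- exact: cup_rpush.
- exact: rpull_contracted_exc.
- apply: zspan_contracted.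
  have := rpush_rpull laws pi2h (excY x).
  by rewrite (deg_involution_quotient laws _ tauh2 resZY tauh_nonfree_finite).
- rewrite excYE.
  apply: (rpull_effective laws tau4 resZ tauhE rZYE pi2h (E := n_curve nz)).
    by move=> C /(n_exceptional nz).
  by apply/(exceptional_exc ny); exists x.
- have := rpush_exceptional laws resZ tauhE rZYE pi2h (exn a).
  apply: zspan_mono => _ [D /(exceptional_exc ny)[x ->] <-].
  by exists x; rewrite ?excYE.
Qed.

Lemma rpush_tau x : rpush pi4 (pull tau x) = rpush pi4 x.
Proof. exact: (rpush_aut laws pi4 x tau4 resY tau_nonfree_finite). Qed.

Notation p := (rpush pi4).

Lemma rpush_f i : p (f_ mk i) = p (e_ mk i).
Proof. by have [<- _ _ _] := tau_D4 mk i; rewrite rpush_tau. Qed.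

Lemma rpush_g i : p (g_ mk i) = p (e_ mk i).
Proof. by have [_ <- _ _] := tau_D4 mk i; rewrite rpush_tau rpush_f. Qed.

Lemma rpush_h i : p (h_ mk i) = p (e_ mk i).
Proof. by have [_ _ <- _] := tau_D4 mk i; rewrite rpush_tau rpush_g. Qed.

Lemma rpush_a2 : p (a_ mk)⟦2⟧ = p (a_ mk)⟦1⟧.
Proof. by rewrite -(tau_a mk).1 rpush_tau. Qed.

Lemma rpush_beta : p (beta mk) = p (alpha mk).
Proof. by rewrite betaE rpush_tau. Qed.

Lemma rpush_sigma : p (sigma mk) = 0.
Proof.
apply: (H2_torsion_free laws (k := 2)) => //.
by rewrite mulr2n -{1}rpush_tau tau_sigma (morphDN (rpushD laws pi4)) addNr.
Qed.

Lemma rpush_rho : p (rho mk) = p (chi mk) *+ 2.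
Proof.
by rewrite -(morphDMn (rpushD laws pi4)) chiE (rpushD laws) rpush_sigma addr0.
Qed.

(** The relation for 4 [alpha], pushed to [Y] and divided by 2. The division takes place in the
    integers, after pairing with an arbitrary class. *)
Lemma rpush_chi : p (chi mk)
  = p (alpha mk) *+ 2 - p (e_ mk)⟦1⟧ *+ 2 - p (e_ mk)⟦2⟧ - p (e_ mk)⟦4⟧.
Proof.
have := congr1 p (alphaE mk).
rewrite (morphDMn (rpushD laws pi4)) !(rpushD laws, morphDMn (rpushD laws pi4)).
rewrite !rpush_f rpush_sigma rpush_rho => alE.
apply: (cup_inj laws) => v; have := congr1 (cup v) alE.
by rewrite !(cupEr laws); lia.
Qed.

Lemma rpush_epsilon : p (epsilon mk)
  = p (chi mk) + p (e_ mk)⟦2⟧ + p (e_ mk)⟦4⟧ + p (a_ mk)⟦1⟧.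
Proof.
have := congr1 p (epsilonE mk).
rewrite (morphDMn (rpushD laws pi4)) !(rpushD laws).
rewrite !rpush_f !rpush_h rpush_rho rpush_a2 => epE.
apply: (cup_inj laws) => v; have := congr1 (cup v) epE.
by rewrite !(cupEr laws); lia.
Qed.

Notation P := (rpush pi2h).

Definition rpushE := (rpush_tower, rpush_f, rpush_g, rpush_h, rpush_a2,
  rpush_beta, rpush_sigma, rpush_rho, rpush_epsilon, rpush_chi).

Ltac push_relation zE :=
  have := congr1 (rpush pi2h) zE;
  rewrite (morphDMn (rpushD laws pi2h)) !(rpushD laws pi2h) !rpush_tower.

(** The subtracted sum is the exceptional part of 2 y_3 + 4 y_2, chosen so that the remaining
    classes from [X] cancel against those of 2 z_1 modulo twice the image of [p]. The next relations
    treat the other z_j in the same way. *)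
Lemma glue_n28 : exists w, w *+ 2 = P (n_ nz)⟦2⟧ + P (n_ nz)⟦8⟧
  - ((m_ ny)⟦4⟧⟦1⟧ + (m_ ny)⟦4⟧⟦3⟧ + (mt_ ny)⟦2⟧
     + (m_ ny)⟦3⟧⟦1⟧ + (m_ ny)⟦3⟧⟦2⟧ *+ 2 + (m_ ny)⟦3⟧⟦3⟧ *+ 3
     + (m_ ny)⟦4⟧⟦1⟧ + (m_ ny)⟦4⟧⟦2⟧ *+ 2 + (m_ ny)⟦4⟧⟦3⟧ *+ 3
     + (mt_ ny)⟦2⟧ *+ 2).
Proof.
exists (P (z_ nz)⟦1⟧ - (y_ ny)⟦3⟧ - (y_ ny)⟦2⟧ *+ 2
  - (p (e_ mk)⟦1⟧ + p (e_ mk)⟦2⟧ - p (alpha mk) - p (zeta mk) - p (eta mk))).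
push_relation (z1E nz) => zE.
apply: (cup_inj laws) => v; have := congr1 (cup v) zE.
have := congr1 (cup v) (y3E ny); have := congr1 (cup v) (y2E ny).
rewrite !rpushE !(cupEr laws); lia.
Qed.

Lemma glue_n38 : exists w, w *+ 2 = P (n_ nz)⟦3⟧ + P (n_ nz)⟦8⟧
  - ((mt_ ny)⟦1⟧ + (mt_ ny)⟦2⟧).
Proof.
exists (P (z_ nz)⟦2⟧ - (y_ ny)⟦4⟧ - (p (alpha mk) - p (e_ mk)⟦1⟧)).
push_relation (z2E nz) => zE.
apply: (cup_inj laws) => v; have := congr1 (cup v) zE.
have := congr1 (cup v) (y4E ny); rewrite !rpushE !(cupEr laws); lia.
Qed.

Lemma glue_n48 : exists w, w *+ 2 = P (n_ nz)⟦4⟧ + P (n_ nz)⟦8⟧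
  - ((mt_ ny)⟦1⟧ + (mt_ ny)⟦2⟧).
Proof.
exists (P (z_ nz)⟦3⟧ - (y_ ny)⟦4⟧).
push_relation (z3E nz) => zE.
apply: (cup_inj laws) => v; have := congr1 (cup v) zE.
have := congr1 (cup v) (y4E ny); rewrite !rpushE !(cupEr laws); lia.
Qed.

Lemma glue_n58 : exists w, w *+ 2 = P (n_ nz)⟦5⟧ + P (n_ nz)⟦8⟧.
Proof.
exists (P (z_ nz)⟦4⟧
  - (p (alpha mk) - p (e_ mk)⟦1⟧ + p (a_ mk)⟦1⟧ + p (chi mk))).
push_relation (z4E nz) => zE.
apply: (cup_inj laws) => v; have := congr1 (cup v) zE.
rewrite !rpushE !(cupEr laws); lia.
Qed.

(** Here the subtracted sum is the exceptional part of 2 y_3 + 4 y_2 + 4 y_1. *)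
Lemma glue_n68 : exists w, w *+ 2 = P (n_ nz)⟦6⟧ + P (n_ nz)⟦8⟧
  - ((m_ ny)⟦4⟧⟦1⟧ + (m_ ny)⟦4⟧⟦3⟧ + (mt_ ny)⟦2⟧
     + (m_ ny)⟦3⟧⟦1⟧ + (m_ ny)⟦3⟧⟦2⟧ *+ 2 + (m_ ny)⟦3⟧⟦3⟧ *+ 3
     + (m_ ny)⟦4⟧⟦1⟧ + (m_ ny)⟦4⟧⟦2⟧ *+ 2 + (m_ ny)⟦4⟧⟦3⟧ *+ 3
     + (mt_ ny)⟦2⟧ *+ 2
     + (m_ ny)⟦2⟧⟦1⟧ + (m_ ny)⟦2⟧⟦2⟧ *+ 2 + (m_ ny)⟦2⟧⟦3⟧ *+ 3
     + (m_ ny)⟦3⟧⟦1⟧ + (m_ ny)⟦3⟧⟦2⟧ *+ 2 + (m_ ny)⟦3⟧⟦3⟧ *+ 3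
     + (mt_ ny)⟦2⟧ *+ 2).
Proof.
exists (P (z_ nz)⟦5⟧ - (y_ ny)⟦3⟧ - (y_ ny)⟦2⟧ *+ 2 - (y_ ny)⟦1⟧ *+ 2
  - (p (alpha mk) - p (e_ mk)⟦1⟧ *+ 2 - p (e_ mk)⟦4⟧ *+ 2 - p (zeta mk) *+ 2
     - p (eta mk) *+ 2 - p (a_ mk)⟦1⟧)).
push_relation (z5E nz) => zE.
apply: (cup_inj laws) => v; have := congr1 (cup v) zE.
have := congr1 (cup v) (y3E ny); have := congr1 (cup v) (y2E ny).
have := congr1 (cup v) (y1E ny); rewrite !rpushE !(cupEr laws); lia.
Qed.

Lemma glue_n78 : exists w, w *+ 2 = P (n_ nz)⟦7⟧ + P (n_ nz)⟦8⟧
  - ((m_ ny)⟦4⟧⟦1⟧ + (m_ ny)⟦4⟧⟦3⟧ + (mt_ ny)⟦2⟧).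
Proof.
exists (P (z_ nz)⟦6⟧ - (y_ ny)⟦3⟧
  - (p (e_ mk)⟦2⟧ + p (a_ mk)⟦1⟧ + p (chi mk))).
push_relation (z6E nz) => zE.
apply: (cup_inj laws) => v; have := congr1 (cup v) zE.
have := congr1 (cup v) (y3E ny); rewrite !rpushE !(cupEr laws); lia.
Qed.

Lemma glue_nu : P (nu nz) *+ 2
  = P (n_ nz)⟦1⟧ + P (n_ nz)⟦2⟧ + P (n_ nz)⟦3⟧ + P (n_ nz)⟦4⟧
    + P (n_ nz)⟦5⟧ + P (n_ nz)⟦6⟧ + P (n_ nz)⟦7⟧ + P (n_ nz)⟦8⟧.
Proof.
rewrite -(morphDMn (rpushD laws pi2h)) nuE (morphD_sum (rpushD laws pi2h)).
rewrite !big_ord_recl big_ord0 addr0 !addrA.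
by do 7?congr (_ + _); congr (P (n_ nz _)); apply: val_inj; rewrite /= inordK.
Qed.

Notation coded := (coded ny).
Notation lat := (zspan (range (exc (m_ ny) (mt_ ny)))).

Lemma zspan_m i j : lat (m_ ny i j).
Proof. by apply: sub_zspan; exists (inl (i, j)). Qed.

Lemma zspan_mt k : lat (mt_ ny k).
Proof. by apply: sub_zspan; exists (inr k). Qed.

Lemma lat_subgroup : is_subgroup lat.
Proof. exact: zspan_subgroup. Qed.

Ltac in_lattice :=
  repeat first
    [ exact: zspan_m | exact: zspan_mt | exact: coded_in_lattice
    | exact: lat_subgroup.1 | apply: lat_subgroup.2
    | apply: (is_subgroupMn _ lat_subgroup)
    | apply: (is_subgroupD lat_subgroup) ].

Definition coordE := (phiE laws ny, phi_m, phi_mt, psi_m laws ny, psi_mt,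
  phi_coded laws ny, psi_coded laws ny).

(** Each glue relation shows that a sum of coded values, corrected by known curves, is twice a class
    of M. The congruences on [phi] and [psi] then leave few codes. *)
Lemma rpush_nE : [/\ P (n_ nz)⟦1⟧ = coded 1, P (n_ nz)⟦2⟧ = coded 3,
    P (n_ nz)⟦3⟧ = coded 5 & P (n_ nz)⟦4⟧ = coded 5] /\
  [/\ P (n_ nz)⟦5⟧ = coded 6, P (n_ nz)⟦6⟧ = coded 2,
    P (n_ nz)⟦7⟧ = coded 4 & P (n_ nz)⟦8⟧ = coded 6].
Proof.
have code i := codedP (rpush_n i).
have [c1 l1 E1] := code (inord 1.-1); have [c2 l2 E2] := code (inord 2.-1).
have [c3 l3 E3] := code (inord 3.-1); have [c4 l4 E4] := code (inord 4.-1).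
have [c5 l5 E5] := code (inord 5.-1); have [c6 l6 E6] := code (inord 6.-1).
have [c7 l7 E7] := code (inord 7.-1); have [c8 l8 E8] := code (inord 8.-1).
have parity w x : lat x -> w *+ 2 = x -> exists s1 s2 s3 t0 t1 : int,
    [/\ phi ny 1 x = phi ny 0 x + s1 * 8, phi ny 2 x = phi ny 0 x + s2 * 8,
      phi ny 3 x = phi ny 0 x + s3 * 8, psi ny 0 x = phi ny 0 x + t0 * 4
      & psi ny 1 x = phi ny 0 x + t1 * 4].
  move=> /(sub_exceptional_lattice (ny := ny)) Mx wE.
  have par := parity_double laws wE Mx.
  have [s1 [t0 [? ?]]] := par 1%N 0%N isT isT.
  have [s2 [t1 [? ?]]] := par 2%N 1%N isT isT.
  have [s3 [_ [? _]]] := par 3%N 0%N isT isT.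
  by exists s1, s2, s3, t0, t1.
(* A relation symmetric in two unknown codes fixes them only up to order. The relations for n_7, n_8
   and for n_3, n_8 share n_8, whose code must therefore be 6. *)
have h78 : (c7 = 4 /\ c8 = 6 \/ c7 = 6 /\ c8 = 4)%N.
  have [w] := glue_n78; rewrite E7 E8 => /parity[].
    by in_lattice.
  move=> s1 [s2 [s3 [t0 [t1 []]]]]; rewrite !coordE //=.
  clear - l7 l8; case: c7 l7 => [|[|[|[|[|[|[|//]]]]]]] _;
  by case: c8 l8 => [|[|[|[|[|[|[|//]]]]]]] _ /=; lia.
have h38 : (c3 = 5 /\ c8 = 6 \/ c3 = 6 /\ c8 = 5)%N.
  have [w] := glue_n38; rewrite E3 E8 => /parity[].
    by in_lattice.
  move=> s1 [s2 [s3 [t0 [t1 []]]]]; rewrite !coordE //=.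
  clear - l3 l8; case: c3 l3 => [|[|[|[|[|[|[|//]]]]]]] _;
  by case: c8 l8 => [|[|[|[|[|[|[|//]]]]]]] _ /=; lia.
have [e7 e8 e3] : [/\ c7 = 4, c8 = 6 & c3 = 5]%N by split; lia.
rewrite e7 e8 e3 in E7 E8 E3 *.
have e2 : c2 = 3%N.
  have [w] := glue_n28; rewrite E2 E8 => /parity[].
    by in_lattice.
  move=> s1 [s2 [s3 [t0 [t1 []]]]]; rewrite !coordE //=.
  by clear - l2; case: c2 l2 => [|[|[|[|[|[|[|//]]]]]]] _ /=; lia.
have e4 : c4 = 5%N.
  have [w] := glue_n48; rewrite E4 E8 => /parity[].
    by in_lattice.
  move=> s1 [s2 [s3 [t0 [t1 []]]]]; rewrite !coordE //=.
  by clear - l4; case: c4 l4 => [|[|[|[|[|[|[|//]]]]]]] _ /=; lia.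
have e5 : c5 = 6%N.
  have [w] := glue_n58; rewrite E5 E8 => /parity[].
    by in_lattice.
  move=> s1 [s2 [s3 [t0 [t1 []]]]]; rewrite !coordE //=.
  by clear - l5; case: c5 l5 => [|[|[|[|[|[|[|//]]]]]]] _ /=; lia.
have e6 : c6 = 2%N.
  have [w] := glue_n68; rewrite E6 E8 => /parity[].
    by in_lattice.
  move=> s1 [s2 [s3 [t0 [t1 []]]]]; rewrite !coordE //=.
  by clear - l6; case: c6 l6 => [|[|[|[|[|[|[|//]]]]]]] _ /=; lia.
(* n_1 occurs in none of the z_j; it is found last, from the half sum [nu] of all n's. *)
have e1 : c1 = 1%N.
  have := glue_nu; rewrite E1 E2 E3 E4 E5 E6 E7 E8 e2 e4 e5 e6 => /parity[].
    by in_lattice.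
  move=> s1 [s2 [s3 [t0 [t1 []]]]]; rewrite !coordE //=.
  by clear - l1; case: c1 l1 => [|[|[|[|[|[|[|//]]]]]]] _ /=; lia.
by rewrite E1 E2 E3 E4 E5 E6 E7 E8 e1 e2 e4 e5 e6.
Qed.

End Pushforward.

(** * Intersection numbers of the folded classes *)

Section Diagonal.
Variables (R : realType) (G : geometry R) (laws : geometry_laws G).
Variables (X Y : surf G) (tau : mor X X) (mk : marking tau).
Variables (rY : pt Y -> set (pt X)) (p : H2 X -> H2 Y).
Variable ny : numbering_Y mk rY p.

Notation foldedY := (folded (m_ ny) (mt_ ny)).

(** Only the middle curve pairs with a folded class, to -2, and its coefficient is 2 in an A_3 and 1
    for an isolated curve. *)
Lemma cup_folded2 u v : cup (foldedY u) (foldedY v) =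
  if u == v then (if u is inl _ then -4 else -2) else 0.
Proof.
have cupf x := cup_folded laws (m_gram ny) (mt_gram ny) (m_mt_gram ny) x v.
case: u => [i|k]; last by rewrite (cupf (inr k)); case: v {cupf} => [i|l].
rewrite {1}/folded (cupC laws) !(cupDr laws) !(cupC laws (foldedY v)).
rewrite (cupf (inl (i, inord 0))) (cupf (inl (i, inord 1))).
rewrite (cupf (inl (i, inord 2))); case: v {cupf} => [i'|l] //=.
rewrite -![inl (i, _) == _]/((i, inord _) == (i', inord 1)).
rewrite -[inl _ == _]/(i == i') !xpair_eqE -!val_eqE /= !inordK //.
by case: eqP.
Qed.

Lemma cup_coded (i j : 'I_6) : cup (coded ny i.+1) (coded ny j.+1) =
  if i == j then [:: -4; -4; -4; -4; -2; -2]`_i else 0.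
Proof.
(* The code 0 is left out, so the index [i] corresponds to the code [i.+1]. *)
pose lab (i : 'I_6) : 'I_4 + 'I_2 :=
  if (i < 4)%N then inl (inord i) else inr (inord (i - 4)).
have labE (k : 'I_6) : coded ny k.+1 = foldedY (lab k).
  by case: k => -[|[|[|[|[|[|]]]]]].
have lab_inj : injective lab.
  move=> a b; rewrite /lab; case: ifP => a4; case: ifP => b4 // [] /eqP.
    by rewrite -val_eqE /= !inordK // => /eqP/val_inj.
  rewrite -val_eqE /= !inordK => [/eqP ab||]; first apply: val_inj => /=.
  - by move: a4 b4 ab; lia.
  - by case: (b) => k /=; lia.
  - by case: (a) => k /=; lia.
rewrite !labE cup_folded2 (inj_eq lab_inj); case: eqP => // _.
by rewrite /lab; case: i => -[|[|[|[|[|[|]]]]]].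
Qed.

End Diagonal.

Theorem proposition4p3p2 (R : realType) (G : geometry R)
  (laws : geometry_laws G)
  (X Z Y : surf G) (K3X : is_K3 X) (K3Z : is_K3 Z) (K3Y : is_K3 Y)
  (tau : mor X X) (tau_order : has_order tau 4) (tau_sympl : symplectic tau)
  (rZ : pt Z -> set (pt X)) (resZ : min_resolution (compm tau tau) 2 rZ)
  (rY : pt Y -> set (pt X)) (resY : min_resolution tau 4 rY)
  (tauh : mor Z Z) (tauh_order : has_order tauh 2)
  (tauhE : forall t, rZ (tauh t) = tau @` rZ t)
  (rZY : pt Y -> set (pt Z)) (resZY : min_resolution tauh 2 rZY)
  (rZYE : forall t, rY t = \bigcup_(s in rZY t) rZ s)
  (pi2 : quotient_map (compm tau tau) rZ) (pi4 : quotient_map tau rY)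
  (pi2h : quotient_map tauh rZY)
  (mk : marking tau)
  (nz : numbering_Z mk rZ (rpush pi2)) (ny : numbering_Y mk rY (rpush pi4))
  (g1 g2 : H2 Z)
  (g1E : g1 *+ 2 = (n_ nz)⟦3⟧ + (n_ nz)⟦4⟧ + (n_ nz)⟦5⟧ + (n_ nz)⟦8⟧
                   + rpush pi2 (sigma mk))
  (g2E : g2 *+ 4 =
     ((n_ nz)⟦3⟧ + (n_ nz)⟦4⟧
      + (rpush pi2 (e_ mk)⟦1⟧ - rpush pi2 (f_ mk)⟦1⟧)
      + (rpush pi2 (e_ mk)⟦4⟧ - rpush pi2 (f_ mk)⟦4⟧)) *+ 2
     + (rpush pi2 (a_ mk)⟦1⟧ - rpush pi2 (a_ mk)⟦2⟧ + rpush pi2 (sigma mk))) :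
  let Omega4 := coinvariant_lattice tau in
  let Rhat := rpush pi2 @` Omega4 in
  let Gamma := zspan (Rhat `|` nikulin_lattice nz `|` [set g1; g2]) in
  let M := exceptional_lattice ny in
  let P := rpush pi2h in
  [/\ P @` Gamma `<=` M,
      (forall x, Omega4 x -> P (rpush pi2 x) = rpush pi4 x /\ rpush pi4 x = 0)
      /\ (forall x, Rhat x -> P x = 0),
      [/\ P (n_ nz)⟦1⟧ = (m_ ny)⟦1⟧⟦1⟧ + (m_ ny)⟦1⟧⟦2⟧ *+ 2 + (m_ ny)⟦1⟧⟦3⟧,
          P (n_ nz)⟦2⟧ = (m_ ny)⟦3⟧⟦1⟧ + (m_ ny)⟦3⟧⟦2⟧ *+ 2 + (m_ ny)⟦3⟧⟦3⟧,
          P (n_ nz)⟦6⟧ = (m_ ny)⟦2⟧⟦1⟧ + (m_ ny)⟦2⟧⟦2⟧ *+ 2 + (m_ ny)⟦2⟧⟦3⟧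
        & P (n_ nz)⟦7⟧ = (m_ ny)⟦4⟧⟦1⟧ + (m_ ny)⟦4⟧⟦2⟧ *+ 2 + (m_ ny)⟦4⟧⟦3⟧],
      [/\ P (n_ nz)⟦3⟧ = (mt_ ny)⟦1⟧, P (n_ nz)⟦4⟧ = (mt_ ny)⟦1⟧,
          P (n_ nz)⟦5⟧ = (mt_ ny)⟦2⟧ & P (n_ nz)⟦8⟧ = (mt_ ny)⟦2⟧]
    & is_diagonal_lattice (P @` zspan (range (n_ nz)))
        [:: -4; -4; -4; -4; -2; -2]].

Proof.
move=> Omega4 Rhat Gamma M P.
have PD : {morph P : x y / x + y} := rpushD laws pi2h.
have tower x : P (rpush pi2 x) = rpush pi4 x.
  exact: (rpush_tower laws tau_order tauh_order resY tauhE rZYE pi2 pi2h ny).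
have fin := tau_nonfree_finite laws tau_order resY ny.
have pi4_0 x : Omega4 x -> rpush pi4 x = 0.
  exact: (rpush_coinvariant laws pi4 tau_order resY fin).
have [[P1 P2 P3 P4] [P5 P6 P7 P8]] := rpush_nE laws tau_order tauh_order
  resZ resY resZY tauhE rZYE pi2h nz ny.
have [subM Mdiv] : is_primitive M by apply: primitive_closure_primitive.
have codedM c : M (coded ny c).
  by apply: sub_exceptional_lattice; apply: coded_in_lattice.
have PnM i : M (P (n_ nz i)).
  rewrite /P; have [c _ ->] := codedP (rpush_n laws tau_order tauh_order resZ resZY
    tauhE rZYE pi2h nz ny i).
  exact: codedM.
have Mhalf w : M (w *+ 2) -> M w by apply: Mdiv.
split.
(* It suffices to treat generators. [Rhat] goes to 0, and a multiple of each other generator goes to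
   a sum of images of n's, so primitivity of M applies. *)
- move=> _ [x Gx <-]; move: x Gx; apply: (zspan_morph PD subM).
  move=> x [[[y Oy <-]|]|[->|->]].
  + by rewrite tower pi4_0 //; case: subM.
  + apply: (zspan_morph PD subM) => _ [[i _ <-]|->] //.
    apply: Mhalf; rewrite -(morphDMn PD) nuE (morphD_sum PD).
    exact: is_subgroup_sum.
  + apply: Mhalf; rewrite -(morphDMn PD) g1E !PD tower.
    rewrite (rpush_sigma laws tau_order resY ny) addr0.
    by do ?apply: (is_subgroupD subM); apply: PnM.
  (* The differences of conjugate classes and [sigma] go to 0, so 4 [g2] goes to twice the sum of
     the images of n_3 and n_4. *)
  + apply: (Mdiv 4%N) => //; rewrite -(morphDMn PD) g2E PD (morphDMn PD) !PD.
    rewrite !(morphDN PD) !tower !(rpush_f laws tau_order resY ny).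
    rewrite (rpush_a2 laws tau_order resY ny).
    rewrite (rpush_sigma laws tau_order resY ny) !subrr !addr0.
    by apply: (is_subgroupMn _ subM); apply: (is_subgroupD subM).
- by split=> [x Ox|_ [x Ox <-]]; rewrite tower pi4_0.
- by rewrite /P P1 P2 P6 P7.
- by rewrite /P P3 P4 P5 P8.
(* The codes 1 to 6 are attained by n_1, n_6, n_2, n_7, n_3, n_5 in this order. *)
have v_image (i : 'I_6) : exists2 x, zspan (range (n_ nz)) x & P x = coded ny i.+1.
  have gen k : zspan (range (n_ nz)) (n_ nz k) by apply: sub_zspan; exists k.
  case: i => -[|[|[|[|[|[|//]]]]]] _ /=.
  - by exists (n_ nz)⟦1⟧.
  - by exists (n_ nz)⟦6⟧.
  - by exists (n_ nz)⟦2⟧.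
  - by exists (n_ nz)⟦7⟧.
  - by exists (n_ nz)⟦3⟧.
  - by exists (n_ nz)⟦5⟧.
have gram := cup_coded laws ny.
exists (fun i : 'I_6 => coded ny i.+1); split=> // [c c0 i|].
  (* Pairing with one member of an orthogonal family with nonzero squares isolates its
     coefficient. *)
  have := congr1 (cup (coded ny i.+1)) c0.
  rewrite (cup_sumr laws) (cup0r laws) (bigD1 i) //= big1 => [|j ji].
    rewrite addr0 (cupMzr laws) gram eqxx.
    by move: (c i); case: i => -[|[|[|[|[|[|//]]]]]] _ z /=; lia.
  by rewrite (cupMzr laws) gram eq_sym (negPf ji) mul0r.
have span_sub := zspan_subgroup (range (fun i : 'I_6 => coded ny i.+1)).
have gen (i : 'I_6) : zspan (range (fun i : 'I_6 => coded ny i.+1)) (coded ny i.+1).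
  by apply: sub_zspan; exists i.
apply/seteqP; split=> [_ [x nx <-]|].
  move: x nx; apply: (zspan_morph PD span_sub) => _ [i _ <-].
  (* The value 0 lies in any span, so here it is enough that every image of an n is one of the seven
     coded values. *)
  rewrite /P; have [[|c] c7 ->] := codedP (rpush_n laws tau_order tauh_order resZ resZY
    tauhE rZYE pi2h nz ny i); first exact: span_sub.1.
  exact: (gen (Ordinal (c7 : (c < 6)%N))).
apply: zspan_min => [|_ [i _ <-]]; last by have [x nx <-] := v_image i; exists x.
have [n0 nB] := zspan_subgroup (range (n_ nz)).
split=> [|_ _ [x nx <-] [y ny' <-]]; first by exists 0; rewrite ?(morphD0 PD).
by exists (x - y); [exact: nB|rewrite (morphDB PD)].
Qed.
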